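(* Assume the setting and Assumptions 1–2 of the context, and run the FedAvg algorithm with constant stepsize $\eta=\sqrt{bK/T}$ and, for a fixed $\nu\in[0,1]$, $$I=\mathcal{O}\big((T/K^3)^{\nu/4}\big),\qquad b=\mathcal{O}\big((T/K^3)^{1/3-\nu/3}\big),$$ with $T\ge81L^2I^2bK$. Then: (i) $$\mathbb{E}\|\nabla f(\bar x_a)\|^2=\mathcal{O}\Big(\frac{f(\bar x_1)-f^\ast}{K^{\nu/2}T^{2/3-\nu/6}}\Big)+\mathcal{O}\Big(\frac{\sigma^2}{K^{\nu/2}T^{2/3-\nu/6}}\Big)+\mathcal{O}\Big(\frac{\zeta^2}{K^{\nu/2}T^{2/3-\nu/6}}\Big);$$ (ii) for every $\nu\in[0,1]$, the sample complexity of FedAvg is $\mathcal{O}(\epsilon^{-2})$, i.e. $\mathcal O(K^{-1}\epsilon^{-2})$ gradient computations per worker, and its communication complexity is $\mathcal{O}(\epsilon^{-3/2})$.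
   Context: Setting: $K\ge1$ worker nodes. For each $k$, $f^{(k)}(x)=\mathbb{E}_{\xi\sim\mathcal{D}^{(k)}}[f^{(k)}(x;\xi)]$ on $\mathbb{R}^d$. The objective is $f=\frac1K\sum_kf^{(k)}$, with $f^\ast=\inf f>-\infty$. Assumption 1: $\mathbb{E}\|\nabla f^{(k)}(x;\xi)-\nabla f^{(k)}(y;\xi)\|^2\le L^2\|x-y\|^2$. Assumption 2: $\mathbb{E}[\nabla f^{(k)}(x;\xi)]=\nabla f^{(k)}(x)$, $\mathbb{E}\|\nabla f^{(k)}(x;\xi)-\nabla f^{(k)}(x)\|^2\le\sigma^2$, and $\|\nabla f^{(k)}(x)-\nabla f^{(\ell)}(x)\|^2\le\zeta^2$. Samples are i.i.d., independent across nodes and of the past. FedAvg algorithm (local SGD). Parameters: stepsize $\eta$, number of local updates $I$, minibatch size $b$. Initialization: all $x_1^{(k)}=\bar x_1$. For $t=1,\dots,T$ and each $k$: $d_t^{(k)}=\frac1b\sum_{\xi\in\mathcal{B}_t^{(k)}}\nabla f^{(k)}(x_t^{(k)};\xi)$ with a fresh minibatch, $|\mathcal B_t^{(k)}|=b$, and $x_{t+1}^{(k)}=x_t^{(k)}-\eta d_t^{(k)}$. If $t\bmod I=0$, then $x_{t+1}^{(k)}$ is replaced by $\bar x_{t+1}=\frac1K\sum_jx_{t+1}^{(j)}$ for all $k$ (one communication round). Here $\bar x_t=\frac1K\sum_kx_t^{(k)}$. Output: $\bar x_a$, uniform on $\{\bar x_t\}_{t=1}^T$. Sample complexity is the total number of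 stochastic gradient evaluations to reach $\mathbb{E}\|\nabla f(\bar x_a)\|^2\le\epsilon$. Communication complexity is the number of rounds $T/I$.
   Formalization: The minibatch size b is required to be of exact order (T/K^3)^{1/3-ν/3}, bounded below as well as above by constant multiples, not merely O of it; with b=1 and ν<1 the claimed rate fails. *)

(* Defs.v *)
From HB Require Import structures.
From mathcomp Require Import all_boot all_order all_algebra.
From mathcomp Require Import all_classical all_reals all_analysis.

Set Implicit Arguments.
Unset Strict Implicit.
Unset Printing Implicit Defensive.
Import Order.TTheory GRing.Theory Num.Theory.
Import numFieldNormedType.Exports.
Local Open Scope classical_set_scope.
Local Open Scope ring_scope.

Definition dotv {R : realType} {d : nat} (u v : 'rV[R]_d) : R :=
  \sum_(i < d) u ord0 i * v ord0 i.

Definition sqnorm {R : realType} {d : nat} (v : 'rV[R]_d) : R := dotv v v.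

Definition is_gradient {R : realType} {d : nat}
    (f : 'rV[R]_d -> R) (g : 'rV[R]_d -> 'rV[R]_d) : Prop :=
  forall x : 'rV[R]_d, differentiable f x /\ forall v, 'd f x v = dotv (g x) v.

Definition avgK {R : realType} {d K : nat} (y : 'I_K -> 'rV[R]_d) : 'rV[R]_d :=
  K%:R^-1 *: \sum_(k < K) y k.

Definition fobj {R : realType} {d K : nat} (F : 'I_K -> 'rV[R]_d -> R)
    (x : 'rV[R]_d) : R := K%:R^-1 * \sum_(k < K) F k x.

Definition gradobj {R : realType} {d K : nat} (gradF : 'I_K -> 'rV[R]_d -> 'rV[R]_d)
    (x : 'rV[R]_d) : 'rV[R]_d := avgK (fun k => gradF k x).

Definition is_infimum {R : realType} {d : nat} (f : 'rV[R]_d -> R) (fstar : R) : Prop :=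
  (forall x, fstar <= f x) /\ (forall e : R, 0 < e -> exists x, f x < fstar + e).

(* Joint (Borel x Sigma_Xi) measurability of (x, xi) |-> g(x, xi), expressed
   through compositions: for any measurable Y (componentwise) and Z on any
   measurable space, t |-> g (Y t) (Z t) is (componentwise) measurable. *)
Definition jointly_measurable {R : realType} {d : nat} {dX : measure_display}
    {Xi : measurableType dX} (g : 'rV[R]_d -> Xi -> 'rV[R]_d) : Prop :=
  forall (dT : measure_display) (T : measurableType dT)
         (Y : T -> 'rV[R]_d) (Z : T -> Xi),
    (forall i, measurable_fun setT (fun t => Y t ord0 i)) ->
    measurable_fun setT Z ->
    forall i, measurable_fun setT (fun t => g (Y t) (Z t) ord0 i).

Definition fedavg_setting {R : realType} {d K : nat} {dX : measure_display}
    {Xi : measurableType dX} (D : 'I_K -> probability Xi R)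
    (fs : 'I_K -> 'rV[R]_d -> Xi -> R) (gs : 'I_K -> 'rV[R]_d -> Xi -> 'rV[R]_d)
    (F : 'I_K -> 'rV[R]_d -> R) (gradF : 'I_K -> 'rV[R]_d -> 'rV[R]_d)
    (fstar L sigma zeta : R) : Prop :=
  (0 < K)%N /\
  (forall k xi, is_gradient (fun x => fs k x xi) (fun x => gs k x xi)) /\
  (forall k x, (D k).-integrable setT (fun xi => (fs k x xi)%:E) /\
               (\int[D k]_xi (fs k x xi)%:E = (F k x)%:E)%E) /\
  (forall k, is_gradient (F k) (gradF k)) /\
  is_infimum (fobj F) fstar /\
  (* regularity needed for the expectations below to make sense *)
  (forall k, jointly_measurable (gs k)) /\
  (forall k x y, (\int[D k]_xi (sqnorm (gs k x xi - gs k y xi))%:E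
                    <= (L ^+ 2 * sqnorm (x - y))%:E)%E) /\
  (forall k x (i : 'I_d),
     (D k).-integrable setT (fun xi => (gs k x xi ord0 i)%:E) /\
     (\int[D k]_xi (gs k x xi ord0 i)%:E = (gradF k x ord0 i)%:E)%E) /\
  (forall k x, (\int[D k]_xi (sqnorm (gs k x xi - gradF k x))%:E
                   <= (sigma ^+ 2)%:E)%E) /\
  (forall k l x, sqnorm (gradF k x - gradF l x) <= zeta ^+ 2).

(* xi t k j : Omega -> Xi is the j-th sample of the minibatch B_t^(k). *)

Definition mutually_independent {R : realType} {dO : measure_display}
    {Omega : measurableType dO} {dX : measure_display} {Xi : measurableType dX}
    {Idx : eqType} (P : probability Omega R) (I : Idx -> bool)
    (X : Idx -> Omega -> Xi) : Prop :=
  forall s : seq Idx, uniq s -> (forall i, i \in s -> I i) ->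
  forall A : Idx -> set Xi, (forall i, measurable (A i)) ->
    P (\bigcap_(i in [set` s]) (X i @^-1` A i)) =
    (\prod_(i <- s) P (X i @^-1` A i))%E.

Definition fedavg_sampling {R : realType} {K : nat} {dX : measure_display}
    {Xi : measurableType dX} {dO : measure_display} {Omega : measurableType dO}
    (P : probability Omega R) (D : 'I_K -> probability Xi R)
    (xi : nat -> 'I_K -> nat -> Omega -> Xi) (T b : nat) : Prop :=
  (forall t k j, (1 <= t <= T)%N -> (j < b)%N -> measurable_fun setT (xi t k j)) /\
  (forall t k j, (1 <= t <= T)%N -> (j < b)%N ->
     forall A, measurable A -> P (xi t k j @^-1` A) = D k A) /\
  mutually_independent P
    (fun p : nat * 'I_K * nat => (1 <= p.1.1 <= T)%N && (p.2 < b)%N)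
    (fun p => xi p.1.1 p.1.2 p.2).

(* fedavg_state n omega k = x_{n+1}^(k) (omega). *)
Fixpoint fedavg_state {R : realType} {d K : nat} {dX : measure_display}
    {Xi : measurableType dX} {Omega : Type}
    (gs : 'I_K -> 'rV[R]_d -> Xi -> 'rV[R]_d)
    (xi : nat -> 'I_K -> nat -> Omega -> Xi)
    (eta : R) (I b : nat) (x1 : 'rV[R]_d) (n : nat) (omega : Omega)
    : 'I_K -> 'rV[R]_d :=
  match n with
  | 0 => fun _ => x1
  | n'.+1 =>
      let t := n'.+1 in
      let prev := fedavg_state gs xi eta I b x1 n' omega in
      let y := fun k => prev k - eta *:
                 (b%:R^-1 *: \sum_(j < b) gs k (prev k) (xi t k j omega)) in
      if (t %% I == 0)%N then (fun _ => avgK y) else y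
  end.

Definition fedavg_x {R : realType} {d K : nat} {dX : measure_display}
    {Xi : measurableType dX} {Omega : Type}
    (gs : 'I_K -> 'rV[R]_d -> Xi -> 'rV[R]_d)
    (xi : nat -> 'I_K -> nat -> Omega -> Xi)
    (eta : R) (I b : nat) (x1 : 'rV[R]_d) (t : nat) (omega : Omega) (k : 'I_K)
    : 'rV[R]_d :=
  fedavg_state gs xi eta I b x1 t.-1 omega k.

Definition fedavg_xbar {R : realType} {d K : nat} {dX : measure_display}
    {Xi : measurableType dX} {Omega : Type}
    (gs : 'I_K -> 'rV[R]_d -> Xi -> 'rV[R]_d)
    (xi : nat -> 'I_K -> nat -> Omega -> Xi)
    (eta : R) (I b : nat) (x1 : 'rV[R]_d) (t : nat) (omega : Omega) : 'rV[R]_d :=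
  avgK (fedavg_x gs xi eta I b x1 t omega).

(* E || grad f (\bar x_a) ||^2 with a uniform on {1..T}, independent of the
   samples:  = (1/T) sum_{t=1}^T E || grad f (\bar x_t) ||^2 *)
Definition fedavg_error {R : realType} {d K : nat} {dX : measure_display}
    {Xi : measurableType dX} {dO : measure_display} {Omega : measurableType dO}
    (P : probability Omega R)
    (gs : 'I_K -> 'rV[R]_d -> Xi -> 'rV[R]_d) (gradF : 'I_K -> 'rV[R]_d -> 'rV[R]_d)
    (xi : nat -> 'I_K -> nat -> Omega -> Xi)
    (eta : R) (I b T : nat) (x1 : 'rV[R]_d) : \bar R :=
  ((T%:R^-1)%:E *
   \sum_(1 <= t < T.+1)
      \int[P]_omega (sqnorm (gradobj gradF (fedavg_xbar gs xi eta I b x1 t omega)))%:E)%E.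

Definition fedavg_params {R : realType} (nu cI cb Cb L : R) (K T I b : nat) (eta : R)
    : Prop :=
  let r := T%:R / K%:R ^+ 3 in
  (1 <= T)%N /\ (1 <= I)%N /\ (1 <= b)%N /\
  eta = Num.sqrt (b%:R * K%:R / T%:R) /\
  I%:R <= cI * r `^ (nu / 4) /\
  cb * r `^ (3^-1 - nu / 3) <= b%:R /\ b%:R <= Cb * r `^ (3^-1 - nu / 3) /\
  81 * L ^+ 2 * I%:R ^+ 2 * b%:R * K%:R <= T%:R.

(* Main.v *)
(* Write xbar_t for the averaged iterate, g_t for the gradient of f at xbar_t, m_t for the average
   over k of grad f^(k)(x_t^(k)), and e_t for the averaged minibatch noise.  Averaging does not
   move xbar, so xbar_(t+1) = xbar_t - eta (m_t + e_t), and the descent inequality together with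
   L eta <= 1 gives pathwise
     f(xbar_(t+1)) <= f(xbar_t) - eta/2 |g_t|^2 + eta L^2/2 V_t + L eta^2/2 |e_t|^2
                      - eta <g_t, e_t> + L eta^2 <m_t, e_t>,
   where V_t is the average over k of |x_t^(k) - xbar_t|^2.  Summing before taking expectations
   avoids any question about the measurability of f(xbar_t).  A sample is independent of the
   sigma-algebra generated by all the other samples up to time T, so Fubini's theorem kills the
   inner products and the cross terms of |e_t|^2, leaving E|e_t|^2 <= sigma^2/(bK).  The drift
   satisfies E V_t <= 10 n^2 eta^2 (sigma^2 + zeta^2), with n the number of steps since the last
   communication round, by induction on n using Young's inequality with weight n and
   81 L^2 I^2 eta^2 <= 1.  Hence the error is at most
     2 (f(x_1) - inf f)/(eta T) + 10 L^2 I^2 eta^2 (sigma^2 + zeta^2) + L eta sigma^2/(bK),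
   and the prescribed eta, I, b make each term O(1/rate) with rate = K^(nu/2) T^(2/3 - nu/6).
   For the complexities, T is chosen so that rate is of order 1/eps, and
   T b K <= rate^2 and T/I <= 2 rate^(3/2). *)
Require Import Defs.
From HB Require Import structures.
From mathcomp Require Import all_boot all_order all_algebra.
From mathcomp Require Import all_classical all_reals all_analysis.
From mathcomp Require Import measurable_realfun ring lra.
Import Order.TTheory GRing.Theory Num.Theory.
Import numFieldNormedType.Exports.
Local Open Scope classical_set_scope.
Local Open Scope ring_scope.

Set Implicit Arguments.
Unset Strict Implicit.
Unset Printing Implicit Defensive.

(** * Vectors and the descent inequality *)

Section vectors.
Context {R : realType} {d : nat}.
Implicit Types (u v w : 'rV[R]_d) (a : R).

Lemma dotvC u v : dotv u v = dotv v u.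
Proof. by apply: eq_bigr => i _; rewrite mulrC. Qed.

Lemma dotvDl u v w : dotv (u + v) w = dotv u w + dotv v w.
Proof. by rewrite -big_split; apply: eq_bigr => i _; rewrite mxE mulrDl. Qed.

Lemma dotvDr u v w : dotv u (v + w) = dotv u v + dotv u w.
Proof. by rewrite dotvC dotvDl !(dotvC u). Qed.

Lemma dotvZl a u v : dotv (a *: u) v = a * dotv u v.
Proof. by rewrite mulr_sumr; apply: eq_bigr => i _; rewrite mxE mulrA. Qed.

Lemma dotvZr a u v : dotv u (a *: v) = a * dotv u v.
Proof. by rewrite dotvC dotvZl dotvC. Qed.

Lemma dotvNl u v : dotv (- u) v = - dotv u v.
Proof. by rewrite -scaleN1r dotvZl mulN1r. Qed.

Lemma dotvNr u v : dotv u (- v) = - dotv u v.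
Proof. by rewrite dotvC dotvNl dotvC. Qed.

Lemma dotv0l v : dotv 0 v = 0.
Proof. by rewrite -(scale0r 0) dotvZl mul0r. Qed.

Lemma dotv_suml J (r : seq J) (P : pred J) (F : J -> 'rV[R]_d) v :
  dotv (\sum_(j <- r | P j) F j) v = \sum_(j <- r | P j) dotv (F j) v.
Proof.
by apply: (big_morph (dotv^~ v) _ (dotv0l v)) => x y; rewrite dotvDl.
Qed.

Lemma dotv_sumr J (r : seq J) (P : pred J) (F : J -> 'rV[R]_d) v :
  dotv v (\sum_(j <- r | P j) F j) = \sum_(j <- r | P j) dotv v (F j).
Proof. by rewrite dotvC dotv_suml; under eq_bigr do rewrite dotvC. Qed.

Lemma sqnorm_ge0 u : 0 <= sqnorm u.
Proof. by apply: sumr_ge0 => i _; rewrite -expr2 sqr_ge0. Qed.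

Lemma sqnormE u : sqnorm u = \sum_(i < d) u ord0 i ^+ 2.
Proof. by []. Qed.

Lemma sqr_coord_le u i : u ord0 i ^+ 2 <= sqnorm u.
Proof.
by rewrite sqnormE (bigD1 i)//= lerDl sumr_ge0// => j _; rewrite sqr_ge0.
Qed.

Lemma sqnorm0 : sqnorm (0 : 'rV[R]_d) = 0.
Proof. exact: dotv0l. Qed.

Lemma sqnormD u v : sqnorm (u + v) = sqnorm u + 2 * dotv u v + sqnorm v.
Proof. by rewrite /sqnorm dotvDl !dotvDr (dotvC v u); ring. Qed.

Lemma sqnormN u : sqnorm (- u) = sqnorm u.
Proof. by rewrite /sqnorm dotvNl dotvNr opprK. Qed.

Lemma sqnormB u v : sqnorm (u - v) = sqnorm u - 2 * dotv u v + sqnorm v.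
Proof. by rewrite sqnormD sqnormN dotvNr mulrN. Qed.

Lemma sqnormBC u v : sqnorm (u - v) = sqnorm (v - u).
Proof. by rewrite -sqnormN opprB. Qed.

Lemma sqnormZ a u : sqnorm (a *: u) = a ^+ 2 * sqnorm u.
Proof. by rewrite /sqnorm dotvZl dotvZr mulrA. Qed.

(** Expand [sqnorm (a *: u - v) >= 0] and divide by [a]. *)
Lemma young_dotv a u v : 0 < a -> 2 * dotv u v <= a * sqnorm u + a^-1 * sqnorm v.
Proof.
move=> a0; have := sqnorm_ge0 (a *: u - v).
rewrite sqnormB sqnormZ dotvZl => h.
rewrite -subr_ge0 -(pmulr_rge0 _ a0).
suff -> : a * (a * sqnorm u + a^-1 * sqnorm v - 2 * dotv u v) =
  a ^+ 2 * sqnorm u - 2 * (a * dotv u v) + sqnorm v by [].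
by field; rewrite gt_eqF.
Qed.

Lemma sqnormD_young a u v : 0 < a ->
  sqnorm (u + v) <= (1 + a) * sqnorm u + (1 + a^-1) * sqnorm v.
Proof. by move=> /(young_dotv u v); rewrite sqnormD; lra. Qed.

Lemma sqnormD_le u v : sqnorm (u + v) <= 2 * sqnorm u + 2 * sqnorm v.
Proof. by have := sqnormD_young u v ltr01; rewrite invr1. Qed.

Lemma dotv_norm_le u v : 2 * dotv u v <= sqnorm u + sqnorm v.
Proof. by have := young_dotv u v ltr01; rewrite invr1 !mul1r. Qed.

End vectors.

(** * Averages over the nodes and their variance decomposition *)

Section averages.
Context {R : realType} {d K : nat}.
Implicit Types (y z : 'I_K -> 'rV[R]_d).
Hypothesis K0 : (0 < K)%N.

Let Kn0 : K%:R != 0 :> R. Proof. by rewrite pnatr_eq0 -lt0n. Qed.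

Lemma avgK_cst (c : 'rV[R]_d) : avgK (fun _ : 'I_K => c) = c.
Proof.
by rewrite /avgK sumr_const card_ord -[c *+ K]scaler_nat scalerA mulVf// scale1r.
Qed.

Lemma avgKB y z : avgK (fun k => y k - z k) = avgK y - avgK z.
Proof. by rewrite /avgK big_split/= sumrN scalerBr. Qed.

Lemma avgKZ (a : R) y : avgK (fun k => a *: y k) = a *: avgK y.
Proof. by rewrite /avgK -scaler_sumr !scalerA mulrC. Qed.

Lemma sum_sqnorm_dev y : \sum_k sqnorm (y k - avgK y) =
  \sum_k sqnorm (y k) - K%:R * sqnorm (avgK y).
Proof.
under eq_bigr do rewrite sqnormB.
rewrite !big_split/= sumr_const card_ord -mulr_natl sumrN -mulr_sumr -dotv_suml.
have -> : \sum_k y k = K%:R *: avgK y by rewrite /avgK scalerA divff// scale1r.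
by rewrite dotvZl -/(sqnorm _); ring.
Qed.

Lemma sqnorm_avgK_le y : sqnorm (avgK y) <= K%:R^-1 * \sum_k sqnorm (y k).
Proof.
rewrite ler_pdivlMl ?ltr0n// -subr_ge0 -sum_sqnorm_dev.
by apply: sumr_ge0 => k _; exact: sqnorm_ge0.
Qed.

(** The average minimises the sum of squared distances: the variance decomposition of [y k - c]
    shows the deficit [K * sqnorm (avgK y - c)]. *)
Lemma sum_sqnorm_dev_le y (c : 'rV[R]_d) :
  \sum_k sqnorm (y k - avgK y) <= \sum_k sqnorm (y k - c).
Proof.
have := sum_sqnorm_dev (fun k => y k - c).
rewrite avgKB avgK_cst.
under eq_bigr do rewrite opprB addrA subrK.
by move=> ->; rewrite gerBl mulr_ge0// sqnorm_ge0.
Qed.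

End averages.

Section descent.
Context {R : realType} {d : nat}.
Variables (f : 'rV[R]_d -> R) (g : 'rV[R]_d -> 'rV[R]_d) (L : R).
Hypothesis fg : is_gradient f g.

Lemma is_derive_gradient_line (x v : 'rV[R]_d) (t : R) :
  is_derive t (1 : R) (fun s : R => f (x + s *: v)) (dotv (g (x + t *: v)) v).
Proof.
have [df Ef] := fg (x + t *: v).
pose h (s : R) : 'rV[R]_d := x + s *: v.
have dh : is_diff t h ( *:%R^~ v).
  rewrite -[X in is_diff _ _ X]add0r.
  exact: is_diffD (is_diff_cst x t) (is_diff_scalel t v).
have dth : differentiable h t := @ex_diff _ _ _ _ _ _ _ dh.
have dfh : differentiable (f \o h) t by exact: differentiable_comp.
have -> : dotv (g (x + t *: v)) v = 'D_1 (f \o h) t.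
  rewrite deriveE// diff_comp//=.
  by rewrite Ef diff_val scale1r.
apply: derivableP; exact: diff_derivable.
Qed.

(** The mean value theorem replaces an integral of the gradient: [phi] is [f] along the segment
    minus the linear and quadratic terms of the upper model, and its derivative is nonpositive on
    the open unit interval, so [phi 1 <= phi 0]. *)
Lemma descent_inequality (x v : 'rV[R]_d) : 0 < L ->
  (forall x y, sqnorm (g x - g y) <= L ^+ 2 * sqnorm (x - y)) ->
  f (x + v) <= f x + dotv (g x) v + L / 2 * sqnorm v.
Proof.
move=> L0 lipg.
pose phi (t : R) := f (x + t *: v) - (t * dotv (g x) v + t ^+ 2 * (L / 2 * sqnorm v)).
pose dphi (t : R) := dotv (g (x + t *: v)) v -
  (dotv (g x) v + t *+ 2 * (L / 2 * sqnorm v)).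
have D (t : R) : is_derive t (1 : R) phi (dphi t).
  have := is_derive_gradient_line x v t => ?.
  apply: is_deriveB.
  apply: is_derive_eq.
  by rewrite !scaler0 !add0r /GRing.scale/= !mulr1 -mulr2n [_ * (t *+ 2)]mulrC.
have cphi : {within `[0, 1], continuous phi}.
  apply: continuous_subspaceT => t; apply: differentiable_continuous.
  by apply/derivable1_diffP; have [] := D t.
have [t t01] := MVT ltr01 (fun t _ => D t) cphi.
rewrite /phi !scale1r !scale0r !addr0 subr0 mulr1 !mul1r !mul0r expr1n expr0n/= !mul0r.
suff : dphi t <= 0 by lra.
move: t01; rewrite in_itv/= => /andP[t0 t1].
have Lt0 : 0 < L * t by rewrite mulr_gt0.
rewrite /dphi.
(* With weight [(L * t)^-1] both Young terms are at most [L * t * sqnorm v], which is the derivative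
   of the quadratic term. *)
have := young_dotv (g (x + t *: v) - g x) v (a := (L * t)^-1).
rewrite invr_gt0 => /(_ Lt0); rewrite invrK dotvDl dotvNl.
have := lipg (x + t *: v) x; rewrite addrAC subrr add0r sqnormZ => lip.
have : (L * t)^-1 * sqnorm (g (x + t *: v) - g x) <= L * t * sqnorm v.
  by rewrite ler_pdivrMl// (le_trans lip)//; nra.
lra.
Qed.

End descent.

(** * Independence *)

Section independence.
Context {R : realType} {dT d1 d2 : measure_display} {T : measurableType dT}
  {T1 : measurableType d1} {T2 : measurableType d2}.
Variables (P : probability T R) (W : T -> T1) (xi : T -> T2) (D : probability T2 R).
Hypotheses (mW : measurable_fun setT W) (mxi : measurable_fun setT xi).
Hypothesis indep : forall A B, measurable A -> measurable B ->
  P (W @^-1` A `&` xi @^-1` B) = (P (W @^-1` A) * D B)%E.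

Let W' : {mfun T >-> T1} := HB.pack W (isMeasurableFun.Build _ _ _ _ _ mW).

Let mpair : measurable_fun setT (fun w => (W w, xi w)).
Proof. exact: measurable_fun_pair. Qed.

(** Independence makes the law of the pair agree with the product measure on rectangles, and
    rectangles determine the product measure. *)
Let joint_law (A : set (T1 * T2)) : measurable A ->
  pushforward P (fun w => (W w, xi w)) A = (distribution P W' \x D)%E A.
Proof.
by move=> mA; apply/esym/product_measure_unique => // B C mB mC; exact: indep.
Qed.

Lemma ge0_integral_indep (h : T1 * T2 -> \bar R) :
  measurable_fun setT h -> (forall z, 0 <= h z)%E ->
  (\int[P]_w h (W w, xi w) = \int[P]_w \int[D]_x h (W w, x))%E.
Proof.
move=> mh h0.
have -> : (\int[P]_w h (W w, xi w) =
    \int[pushforward P (fun w => (W w, xi w))]_z h z)%E.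
  by rewrite ge0_integral_pushforward.
rewrite (eq_measure_integral (distribution P W' \x D)%E); last first.
  by move=> A mA _; exact: joint_law.
rewrite fubini_tonelli1// ge0_integral_distribution//.
  exact: measurable_fun_fubini_tonelli_F.
by move=> x; exact: integral_ge0.
Qed.

(** The signed case goes through Fubini, after integrability has been transferred from the joint law
    to the product measure. *)
Lemma integral_indep (h : T1 * T2 -> \bar R) :
  measurable_fun setT h -> P.-integrable setT (fun w => h (W w, xi w)) ->
  (\int[P]_w h (W w, xi w) = \int[P]_w \int[D]_x h (W w, x))%E.
Proof.
move=> mh ih.
have -> : (\int[P]_w h (W w, xi w) =
    \int[pushforward P (fun w => (W w, xi w))]_z h z)%E.
  by rewrite integral_pushforward.
have ihp : (distribution P W' \x D)%E.-integrable setT h.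
  apply/integrableP; split => //.
  rewrite (eq_measure_integral (pushforward P (fun w => (W w, xi w)))); last first.
    by move=> A mA _; apply/esym; exact: joint_law.
  rewrite ge0_integral_pushforward//=; last exact: measurableT_comp.
  by case/integrableP : ih.
rewrite (eq_measure_integral (distribution P W' \x D)%E); last first.
  by move=> A mA _; exact: joint_law.
rewrite -integral12_prod_meas1//.
have /integrableP[mF iF] := integrable_fubini_F ihp.
rewrite integral_distribution//.
apply/integrableP; split; first exact: measurableT_comp.
move: iF; rewrite ge0_integral_distribution//; exact: measurableT_comp.
Qed.

End independence.

(** * The sigma-algebra generated by finitely many samples *)

Section cylinders.
Context {R : realType} {dO dX : measure_display} {Omega : measurableType dO}
  {Xi : measurableType dX} {Idx : eqType}.
Variables (X : Idx -> Omega -> Xi) (s : seq Idx).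

(** A pi-system generating the sigma-algebra of the family [X i], [i] in [s]. Putting that
    sigma-algebra on [Omega] gives a second measurable type, for which depending only on these
    samples is ordinary measurability. *)
Definition cylinders : set (set Omega) :=
  [set B | exists A : Idx -> set Xi, (forall i, measurable (A i)) /\
     B = \bigcap_(i in [set` s]) (X i @^-1` A i)].

Lemma cylindersI : setI_closed cylinders.
Proof.
move=> _ _ [A [mA ->]] [B [mB ->]]; exists (fun i => A i `&` B i); split.
  by move=> i; exact: measurableI.
by rewrite -bigcapI; apply: eq_bigcapr => i _; rewrite preimage_setI.
Qed.

Lemma cylindersT : cylinders setT.
Proof.
exists (fun _ => setT); split => //.
by apply/seteqP; split.
Qed.

Lemma measurable_cylinder_coord i : i \in s ->
  measurable_fun setT (X i : g_sigma_algebraType cylinders -> Xi).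
Proof.
move=> si _ B mB; rewrite setTI; apply: sub_sigma_algebra.
exists (fun j => if j == i then B else setT); split.
  by move=> j; case: ifP.
apply/seteqP; split => [w Bw j _ /=|w /(_ i si)/=]; last by rewrite eqxx.
by case: eqP => [->|].
Qed.

Hypothesis mX : forall i, i \in s -> measurable_fun setT (X i).

Lemma cylinders_measurable : cylinders `<=` measurable.
Proof.
move=> _ [A [mA ->]]; apply: fin_bigcap_measurable; first exact: finite_seq.
by move=> i /= si; rewrite -[X in measurable X]setTI; exact: mX.
Qed.

Lemma measurable_id_cylinders :
  measurable_fun setT (id : Omega -> g_sigma_algebraType cylinders).
Proof.
move=> _ B mB; rewrite setTI preimage_id.
by move: B mB; apply: smallest_sub; [exact: sigma_algebra_measurable|exact: cylinders_measurable].
Qed.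

(** For fixed [C] both sides are finite measures in [B]: the restriction of [P] to the event that
    [X p] lies in [C], and [P] scaled by the probability of that event. They agree on the pi-system
    by mutual independence, hence on the generated sigma-algebra. *)
Lemma cylinders_indep (P : probability Omega R) (I : Idx -> bool) (p : Idx) :
  mutually_independent P I X -> uniq (p :: s) -> (forall i, i \in p :: s -> I i) ->
  measurable_fun setT (X p) ->
  forall B C, @measurable _ (g_sigma_algebraType cylinders) B -> measurable C ->
  P (B `&` X p @^-1` C) = (P B * P (X p @^-1` C))%E.
Proof.
move=> indX /[dup] us /andP[ps us'] Is mXp B C mB mC.
have mXC : measurable (X p @^-1` C).
  by rewrite -[X in measurable X]setTI; exact: mXp.
have PC0 : 0 <= fine (P (X p @^-1` C)) by exact: fine_ge0.
have PCE : (fine (P (X p @^-1` C)))%:E = P (X p @^-1` C).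
  by rewrite fineK// fin_num_measure.
pose m1 : {measure set Omega -> \bar R} := mrestr P mXC.
pose m2 : {measure set Omega -> \bar R} := mscale (NngNum PC0) P.
suff : m1 B = m2 B.
  by rewrite /m1 /m2 /= /mrestr /mscale/= PCE muleC.
apply: (g_sigma_algebra_measure_unique cylinders _ (fun _ => setT)) => //.
- exact: cylinders_measurable.
- by move=> _; exact: cylindersT.
- exact: bigcup_const.
- exact: cylindersI.
- move=> _ [A [mA ->]].
  rewrite /m1 /m2 /= /mrestr /mscale/= PCE.
  (* Prescribing [C] at [p] turns the intersection into a cylinder over [p :: s]; as [p] is not in
     [s], the other factors are unchanged. *)
  pose A' i := if i == p then C else A i.
  have mA' i : measurable (A' i) by rewrite /A'; case: ifP.
  have A'E i : i \in s -> A' i = A i.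
    by rewrite /A'; case: eqP => // -> pIs; rewrite pIs in ps.
  have Is' i : i \in s -> I i by move=> si; rewrite Is// inE si orbT.
  have := indX (p :: s) us Is A' mA'; have -> : [set` p :: s] = p |` [set` s].
    by apply/seteqP; split => i /=; rewrite inE => /predU1P.
  rewrite bigcap_setU1 big_cons.
  rewrite {1 3}/A' eqxx setIC.
  rewrite (eq_bigcapr (G := fun i => X i @^-1` A i)); last first.
    by move=> i /= si; rewrite A'E.
  move=> ->; rewrite (indX s us' Is' A mA); congr (_ * _)%E.
  by rewrite big_seq [RHS]big_seq; apply: eq_bigr => i si; rewrite A'E.
- by move=> _; rewrite /m1 /= /mrestr setTI ltey_eq fin_num_measure.
Qed.

End cylinders.

(** * Square-integrable vectors and gradient oracles *)

Section square_integrable.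
Context {R : realType} {dT : measure_display} {T : measurableType dT}.
Variable P : probability T R.
Implicit Types X Y Z : T -> R.

Definition sqint X := measurable_fun setT X /\
  P.-integrable setT (fun w => (X w ^+ 2)%:E).

Lemma integrable_dominated X Y : measurable_fun setT X ->
  P.-integrable setT (EFin \o Y) -> (forall w, `|X w| <= Y w) ->
  P.-integrable setT (EFin \o X).
Proof.
move=> mX iY XY; apply: le_integrable iY => //; first exact/measurable_EFinP.
by move=> w _ /=; rewrite lee_fin (le_trans (XY w))// ler_norm.
Qed.

Lemma integrable_EFinD X Y : P.-integrable setT (EFin \o X) ->
  P.-integrable setT (EFin \o Y) ->
  P.-integrable setT (EFin \o (fun w => X w + Y w)).
Proof. by move=> iX iY; exact: (integrableD measurableT iX iY). Qed.

Lemma integrable_EFinZ a X : P.-integrable setT (EFin \o X) ->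
  P.-integrable setT (EFin \o (fun w => a * X w)).
Proof. by move=> iX; exact: (integrableZl measurableT a iX). Qed.

Lemma integrable_EFin_cst a : P.-integrable setT (EFin \o (fun=> a)).
Proof. exact: finite_measure_integrable_cst. Qed.

Lemma integrable_EFin_sum J (r : seq J) (F : J -> T -> R) :
  (forall j, P.-integrable setT (EFin \o F j)) ->
  P.-integrable setT (EFin \o (fun w => \sum_(j <- r) F j w)).
Proof.
move=> iF; elim: r => [|j r IH].
  by under eq_fun do rewrite big_nil; exact: integrable_EFin_cst.
by under eq_fun do rewrite big_cons; exact: integrable_EFinD.
Qed.

Lemma Rintegral_sum J (r : seq J) (F : J -> T -> R) :
  (forall j, P.-integrable setT (EFin \o F j)) ->
  \int[P]_w \sum_(j <- r) F j w = \sum_(j <- r) \int[P]_w F j w.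
Proof.
move=> iF; elim: r => [|j r IH].
  rewrite big_nil; under eq_Rintegral do rewrite big_nil.
  by rewrite Rintegral_cst// mul0r.
rewrite big_cons -IH -RintegralD//; last exact: integrable_EFin_sum.
by under eq_Rintegral do rewrite big_cons.
Qed.

Lemma Rintegral_prob_cst (a : R) : \int[P]_w a = a.
Proof.
by rewrite Rintegral_cst// [X in fine X](_ : _ = 1%E) ?mulr1//; exact: probability_setT.
Qed.

Lemma sqint_mul X Y : sqint X -> sqint Y ->
  P.-integrable setT (EFin \o (fun w => X w * Y w)).
Proof.
move=> [mX iX] [mY iY].
apply: (integrable_dominated _ (integrable_EFinD iX iY)).
  exact: measurable_funM.
move=> w; rewrite normrM -(real_normK (num_real (X w))) -(real_normK (num_real (Y w))).
by have := normr_ge0 (X w); have := normr_ge0 (Y w); nra.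
Qed.

Lemma sqint_cst a : sqint (fun=> a).
Proof. by split; [exact: measurable_cst|exact: integrable_EFin_cst]. Qed.

Lemma sqint_integrable X : sqint X -> P.-integrable setT (EFin \o X).
Proof.
move=> sX; have := sqint_mul sX (sqint_cst 1).
by under eq_fun do rewrite mulr1.
Qed.

Lemma sqint_dominated X Y : measurable_fun setT X ->
  P.-integrable setT (EFin \o Y) -> (forall w, X w ^+ 2 <= Y w) -> sqint X.
Proof.
move=> mX iY XY; split => //; apply: (integrable_dominated _ iY).
  exact: measurable_funX.
by move=> w; rewrite ger0_norm ?sqr_ge0.
Qed.

Lemma sqintD X Y : sqint X -> sqint Y -> sqint (fun w => X w + Y w).
Proof.
move=> [mX iX] [mY iY].
apply: (sqint_dominated _
  (integrable_EFinD (integrable_EFinZ 2 iX) (integrable_EFinZ 2 iY))).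
  exact: measurable_funD.
by move=> w /=; have := sqr_ge0 (X w - Y w); nra.
Qed.

Lemma sqintZ a X : sqint X -> sqint (fun w => a * X w).
Proof.
move=> [mX iX]; apply: (sqint_dominated _ (integrable_EFinZ (a ^+ 2) iX)).
  exact: measurable_funM.
by move=> w; rewrite exprMn.
Qed.

Lemma sqint_sum J (r : seq J) (F : J -> T -> R) :
  (forall j, sqint (F j)) -> sqint (fun w => \sum_(j <- r) F j w).
Proof.
move=> iF; elim: r => [|j r IH].
  by under eq_fun do rewrite big_nil; exact: sqint_cst.
by under eq_fun do rewrite big_cons; exact: sqintD.
Qed.

End square_integrable.

Section square_integrable_vectors.
Context {R : realType} {dT : measure_display} {T : measurableType dT} {d : nat}.
Implicit Types Y Z : T -> 'rV[R]_d.

Definition vmeasurable Y := forall i, measurable_fun setT (fun w => Y w ord0 i).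

Lemma vmeasurable_cst v : vmeasurable (fun=> v).
Proof. by move=> i; exact: measurable_cst. Qed.

Lemma vmeasurableD Y Z : vmeasurable Y -> vmeasurable Z ->
  vmeasurable (fun w => Y w + Z w).
Proof.
by move=> mY mZ i; under eq_fun do rewrite mxE; exact: measurable_funD.
Qed.

Lemma vmeasurableZ a Y : vmeasurable Y -> vmeasurable (fun w => a *: Y w).
Proof.
by move=> mY i; under eq_fun do rewrite mxE; exact: measurable_funM.
Qed.

Lemma vmeasurableB Y Z : vmeasurable Y -> vmeasurable Z ->
  vmeasurable (fun w => Y w - Z w).
Proof.
move=> mY mZ; under eq_fun do rewrite -scaleN1r.
exact/vmeasurableD/vmeasurableZ.
Qed.

Lemma vmeasurable_sum J (r : seq J) (F : J -> T -> 'rV[R]_d) :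
  (forall j, vmeasurable (F j)) -> vmeasurable (fun w => \sum_(j <- r) F j w).
Proof.
move=> mF; elim: r => [|j r IH].
  by under eq_fun do rewrite big_nil; exact: vmeasurable_cst.
by under eq_fun do rewrite big_cons; exact: vmeasurableD.
Qed.

Lemma vmeasurable_avgK K (F : 'I_K -> T -> 'rV[R]_d) :
  (forall k, vmeasurable (F k)) -> vmeasurable (fun w => avgK (fun k => F k w)).
Proof. by move=> mF; exact/vmeasurableZ/vmeasurable_sum. Qed.

Lemma measurable_dotv Y Z : vmeasurable Y -> vmeasurable Z ->
  measurable_fun setT (fun w => dotv (Y w) (Z w)).
Proof. by move=> mY mZ; apply: measurable_sum => i; exact: measurable_funM. Qed.

Variable P : probability T R.

Definition vsqint Y := forall i, sqint P (fun w => Y w ord0 i).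

Lemma vsqint_measurable Y : vsqint Y -> vmeasurable Y.
Proof. by move=> sY i; have [] := sY i. Qed.

Lemma vsqint_cst v : vsqint (fun=> v).
Proof. by move=> i; exact: sqint_cst. Qed.

Lemma vsqintD Y Z : vsqint Y -> vsqint Z -> vsqint (fun w => Y w + Z w).
Proof. by move=> sY sZ i; under eq_fun do rewrite mxE; exact: sqintD. Qed.

Lemma vsqintZ a Y : vsqint Y -> vsqint (fun w => a *: Y w).
Proof. by move=> sY i; under eq_fun do rewrite mxE; exact: sqintZ. Qed.

Lemma vsqintB Y Z : vsqint Y -> vsqint Z -> vsqint (fun w => Y w - Z w).
Proof.
by move=> sY sZ; under eq_fun do rewrite -scaleN1r; exact/vsqintD/vsqintZ.
Qed.

Lemma vsqint_sum J (r : seq J) (F : J -> T -> 'rV[R]_d) :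
  (forall j, vsqint (F j)) -> vsqint (fun w => \sum_(j <- r) F j w).
Proof.
move=> sF i; under eq_fun do rewrite summxE.
by apply: sqint_sum => j; exact: sF.
Qed.

Lemma vsqint_avgK K (F : 'I_K -> T -> 'rV[R]_d) :
  (forall k, vsqint (F k)) -> vsqint (fun w => avgK (fun k => F k w)).
Proof. by move=> sF; exact/vsqintZ/vsqint_sum. Qed.

Lemma vsqint_dotv Y Z : vsqint Y -> vsqint Z ->
  P.-integrable setT (EFin \o (fun w => dotv (Y w) (Z w))).
Proof.
move=> sY sZ; apply: (@integrable_EFin_sum _ _ _ P) => i.
exact: (sqint_mul (sY i) (sZ i)).
Qed.

Lemma vsqint_sqnorm Y : vsqint Y ->
  P.-integrable setT (EFin \o (fun w => sqnorm (Y w))).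
Proof. by move=> sY; exact: vsqint_dotv. Qed.

Lemma vsqint_dominated Y X : vmeasurable Y ->
  P.-integrable setT (EFin \o X) -> (forall w, sqnorm (Y w) <= X w) -> vsqint Y.
Proof.
move=> mY iX YX i; apply: (sqint_dominated (mY i) iX) => w.
exact: le_trans (sqr_coord_le _ _) (YX w).
Qed.

(** Only the diagonal of the expanded square survives integration. *)
Lemma sqnorm_sum_orthogonal (J : finType) (e : J -> T -> 'rV[R]_d) (s : R) :
  (forall j, vsqint (e j)) ->
  (forall j, \int[P]_w sqnorm (e j w) <= s) ->
  (forall j j', j != j' -> \int[P]_w dotv (e j w) (e j' w) = 0) ->
  \int[P]_w sqnorm (\sum_j e j w) <= #|J|%:R * s.
Proof.
move=> ie es orth.
have -> : \int[P]_w sqnorm (\sum_j e j w) = \sum_j \int[P]_w sqnorm (e j w).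
  transitivity (\sum_j \sum_j' \int[P]_w dotv (e j w) (e j' w)).
    under eq_bigr => j _.
      rewrite -Rintegral_sum; last by move=> j'; exact: vsqint_dotv.
      over.
    rewrite -Rintegral_sum; last first.
      by move=> j; apply: integrable_EFin_sum => j'; exact: vsqint_dotv.
    apply: eq_Rintegral => w _; rewrite /sqnorm dotv_suml.
    by apply: eq_bigr => j _; rewrite dotv_sumr.
  apply: eq_bigr => j _; rewrite (bigD1 j)//= big1 ?addr0// => j' jj'.
  by rewrite orth// eq_sym.
rewrite mulr_natl -sumr_const; exact: ler_sum.
Qed.

End square_integrable_vectors.

(** * Stochastic gradients: regularity of the mean, size and orthogonality of the noise *)

Section gradient_oracle.
Context {R : realType} {d : nat} {dX : measure_display} {Xi : measurableType dX}.
Variables (D : probability Xi R) (g : 'rV[R]_d -> Xi -> 'rV[R]_d)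
  (gbar : 'rV[R]_d -> 'rV[R]_d) (L s2 : R).
Hypothesis jg : jointly_measurable g.
Hypothesis mean : forall x (i : 'I_d),
  D.-integrable setT (fun z => (g x z ord0 i)%:E) /\
  (\int[D]_z (g x z ord0 i)%:E = (gbar x ord0 i)%:E)%E.
Hypothesis variance : forall x,
  (\int[D]_z (sqnorm (g x z - gbar x))%:E <= s2%:E)%E.

(** Jensen's inequality by way of Young: with [v] the difference of the means and [G = g x - g y],
    integrate [2 <v, G> <= |v|^2 + |G|^2]; the left side becomes [2 |v|^2]. *)
Lemma mean_lipschitz :
  (forall x y, (\int[D]_z (sqnorm (g x z - g y z))%:E
     <= (L ^+ 2 * sqnorm (x - y))%:E)%E) ->
  forall x y, sqnorm (gbar x - gbar y) <= L ^+ 2 * sqnorm (x - y).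
Proof.
move=> lip x y.
have mg x' : vmeasurable (g x').
  by apply: jg => //; exact: vmeasurable_cst.
have mxy := vmeasurableB (mg x) (mg y).
(* The bound on the extended integral also supplies the finite second moment. *)
have inorm : D.-integrable setT (EFin \o (fun z => sqnorm (g x z - g y z))).
  apply/integrableP; split; first exact/measurable_EFinP/measurable_dotv.
  apply: le_lt_trans (ltry (L ^+ 2 * sqnorm (x - y))).
  apply: le_trans (lip x y); rewrite le_eqVlt; apply/orP; left; apply/eqP.
  by apply: eq_integral => z _ /=; rewrite ger0_norm// sqnorm_ge0.
have sxy : vsqint D (fun z => g x z - g y z) by exact: (vsqint_dominated mxy inorm).
set v := gbar x - gbar y.
have Ev : \int[D]_z dotv v (g x z - g y z) = sqnorm v.
  rewrite Rintegral_sum; last first.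
    by move=> i; exact/integrable_EFinZ/sqint_integrable.
  apply: eq_bigr => i _; rewrite RintegralZl//; last exact: sqint_integrable.
  congr (_ * _); under eq_Rintegral do rewrite !mxE.
  rewrite RintegralB//; [|by have [] := mean x i|by have [] := mean y i].
  by rewrite /Rintegral (mean x i).2 (mean y i).2/= !mxE.
have : \int[D]_z (2 * dotv v (g x z - g y z)) <=
       \int[D]_z (sqnorm v + sqnorm (g x z - g y z)).
  apply: le_Rintegral => //.
  - exact/integrable_EFinZ/vsqint_dotv/sxy/vsqint_cst.
  - by apply: integrable_EFinD => //; exact: integrable_EFin_cst.
  - by move=> z _; exact: dotv_norm_le.
rewrite RintegralZl//; last exact/vsqint_dotv/sxy/vsqint_cst.
rewrite Ev RintegralD//; last exact: integrable_EFin_cst.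
rewrite Rintegral_prob_cst => h.
suff : \int[D]_z sqnorm (g x z - g y z) <= L ^+ 2 * sqnorm (x - y) by lra.
by rewrite -lee_fin /Rintegral fineK ?lip//; exact: integrable_fin_num.
Qed.

(** Each coordinate of [gbar] is a parametrised integral of [g], so its measurability comes from
    Tonelli. That result concerns nonnegative integrands, hence the split into positive and negative
    parts. *)
Lemma vmeasurable_mean {d1 : measure_display} {T1 : measurableType d1}
    (Y : T1 -> 'rV[R]_d) :
  vmeasurable Y -> vmeasurable (fun t => gbar (Y t)).
Proof.
move=> mY i.
pose h (z : T1 * Xi) := (g (Y z.1) z.2 ord0 i)%:E.
have mh : measurable_fun setT h.
  apply/measurable_EFinP; apply: (jg (Y := Y \o fst) (Z := snd)) => // j.
  exact: measurableT_comp (mY j) measurable_fst.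
apply/measurable_EFinP.
have -> : EFin \o (fun t => gbar (Y t) ord0 i) =
    ((fun t => \int[D]_z h^\+ (t, z)) \- (fun t => \int[D]_z h^\- (t, z)))%E.
  apply/funext => t /=; rewrite -(mean (Y t) i).2 integralE.
  congr (_ - _)%E; apply: eq_integral => z _.
  - by rewrite !funeposE.
  - by rewrite !funenegE.
apply: emeasurable_funB; apply: measurable_fun_fubini_tonelli_F => //.
- exact: measurable_funepos.
- exact: measurable_funeneg.
Qed.

Context {dT d1 : measure_display} {T : measurableType dT} {T1 : measurableType d1}.
Variables (P : probability T R) (W : T -> T1) (xi : T -> Xi) (Y : T1 -> 'rV[R]_d).
Hypotheses (mW : measurable_fun setT W) (mxi : measurable_fun setT xi)
  (mY : vmeasurable Y).
Hypothesis indep : forall A B, measurable A -> measurable B ->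
  P (W @^-1` A `&` xi @^-1` B) = (P (W @^-1` A) * D B)%E.

Let mnoise : vmeasurable
  (fun z : T1 * Xi => g (Y z.1) z.2 - gbar (Y z.1)).
Proof.
apply: vmeasurableB.
  apply: (jg (Y := Y \o fst) (Z := snd)) => // j.
  exact: measurableT_comp (mY j) measurable_fst.
move=> i; exact: measurableT_comp (vmeasurable_mean mY i) measurable_fst.
Qed.

(** Independence allows [Y (W w)] to be frozen while the fresh sample is integrated; the variance
    bound then applies pointwise. *)
Lemma noise_sqnorm_le :
  (\int[P]_w (sqnorm (g (Y (W w)) (xi w) - gbar (Y (W w))))%:E <= s2%:E)%E.
Proof.
pose h (z : T1 * Xi) := (sqnorm (g (Y z.1) z.2 - gbar (Y z.1)))%:E.
have mh : measurable_fun setT h by exact/measurable_EFinP/measurable_dotv.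
have h0 z : (0 <= h z)%E by rewrite lee_fin sqnorm_ge0.
rewrite (ge0_integral_indep mW mxi indep mh h0).
have -> : s2%:E = (\int[P]_w (cst s2%:E w))%E.
  rewrite integral_cst// [X in (_ * X)%E](_ : _ = 1%E) ?mule1//.
  exact: probability_setT.
apply: ge0_le_integral => //.
- by move=> w _; exact: integral_ge0.
- exact: measurableT_comp (measurable_fun_fubini_tonelli_F _ _ _) mW.
- by move=> w _; exact: (variance (Y (W w))).
Qed.

(** With [W w] frozen, the inner integral is [U (W w)] times the mean of a centred variable. *)
Lemma noise_orthogonal (U : T1 -> R) i : measurable_fun setT U ->
  P.-integrable setT
    (fun w => (U (W w) * (g (Y (W w)) (xi w) - gbar (Y (W w))) ord0 i)%:E) ->
  \int[P]_w (U (W w) * (g (Y (W w)) (xi w) - gbar (Y (W w))) ord0 i) = 0.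
Proof.
move=> mU iU.
pose h (z : T1 * Xi) := (U z.1 * (g (Y z.1) z.2 - gbar (Y z.1)) ord0 i)%:E.
have mh : measurable_fun setT h.
  apply/measurable_EFinP/measurable_funM => //.
  exact: measurableT_comp mU measurable_fst.
rewrite /Rintegral (integral_indep mW mxi indep mh iU).
rewrite (eq_integral (cst 0%E)) ?integral0// => w _; rewrite /h/=.
have [ig Eg] := mean (Y (W w)) i.
under eq_integral do rewrite !mxE EFinM EFinB.
rewrite integralZl//; last exact: integrableB ig (integrable_EFin_cst _ _).
rewrite integralB//; last exact: integrable_EFin_cst.
rewrite Eg integral_cst// [X in (_ - _ * X)%E](_ : _ = 1%E).
  by rewrite mule1 subee// mule0.
exact: probability_setT.
Qed.

End gradient_oracle.

(** * The FedAvg iterates *)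

Lemma fedavg_stateS {R : realType} {d K : nat} {dX : measure_display}
    {Xi : measurableType dX} {Omega : Type}
    (gs : 'I_K -> 'rV[R]_d -> Xi -> 'rV[R]_d) (xi : nat -> 'I_K -> nat -> Omega -> Xi)
    (eta : R) (I b : nat) (x1 : 'rV[R]_d) (n : nat) (w : Omega) (k : 'I_K) :
  let st := fedavg_state gs xi eta I b x1 in
  let y l := st n w l - eta *:
    (b%:R^-1 *: \sum_(j < b) gs l (st n w l) (xi n.+1 l j w)) in
  st n.+1 w k = if (n.+1 %% I == 0)%N then avgK y else y k.
Proof. by move=> /=; case: ifP. Qed.

(** The measurable structure on [Omega] is arbitrary, so the lemma also serves for the coarser
    sigma-algebra generated by a subfamily of the samples. *)
Lemma vmeasurable_fedavg_state {R : realType} {d K : nat} {dX dO : measure_display}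
    {Xi : measurableType dX} {Omega : measurableType dO}
    (gs : 'I_K -> 'rV[R]_d -> Xi -> 'rV[R]_d) (xi : nat -> 'I_K -> nat -> Omega -> Xi)
    (eta : R) (I b : nat) (x1 : 'rV[R]_d) (n : nat) :
  (forall k, jointly_measurable (gs k)) ->
  (forall t k j, (1 <= t <= n)%N -> (j < b)%N -> measurable_fun setT (xi t k j)) ->
  forall k, vmeasurable (fun w => fedavg_state gs xi eta I b x1 n w k).
Proof.
move=> jg; elim: n => [_ k|n IH mxi k]; first exact: vmeasurable_cst.
have {}IH l : vmeasurable (fun w => fedavg_state gs xi eta I b x1 n w l).
  by apply: IH => t l' j /andP[t1 tn] jb; apply: mxi => //; rewrite t1 leqW.
have my l : vmeasurable (fun w => fedavg_state gs xi eta I b x1 n w l - eta *: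
    (b%:R^-1 *: \sum_(j < b) gs l (fedavg_state gs xi eta I b x1 n w l)
                                  (xi n.+1 l j w))).
  apply/vmeasurableB/vmeasurableZ/vmeasurableZ/vmeasurable_sum => //= j.
  by apply: (jg l _ _ _ _ (IH l)); apply: mxi => //; rewrite leqnn.
case E : (n.+1 %% I == 0)%N; under eq_fun do rewrite fedavg_stateS E.
  exact: vmeasurable_avgK.
exact: my.
Qed.

Section run.
Context {R : realType} {d K : nat} {dX : measure_display} {Xi : measurableType dX}.
Variables (D : 'I_K -> probability Xi R)
  (fs : 'I_K -> 'rV[R]_d -> Xi -> R) (gs : 'I_K -> 'rV[R]_d -> Xi -> 'rV[R]_d)
  (F : 'I_K -> 'rV[R]_d -> R) (gradF : 'I_K -> 'rV[R]_d -> 'rV[R]_d)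
  (fstar L sigma zeta : R) (x1 : 'rV[R]_d).
Context {dO : measure_display} {Omega : measurableType dO}.
Variables (P : probability Omega R) (xi : nat -> 'I_K -> nat -> Omega -> Xi)
  (T I b : nat) (eta : R).
Hypotheses (setting : fedavg_setting D fs gs F gradF fstar L sigma zeta)
  (sampling : fedavg_sampling P D xi T b)
  (L0 : 0 < L) (I0 : (0 < I)%N) (b0 : (0 < b)%N) (eta0 : 0 < eta)
  (etaI : 81 * L ^+ 2 * I%:R ^+ 2 * eta ^+ 2 <= 1).

Local Notation st := (fedavg_state gs xi eta I b x1).
Let xb n w := avgK (st n w).
(** Index shift: [st n] is the iterate of time [n.+1], so step [n] draws the samples of time
    [n.+1]. *)
Let noise n k j w := gs k (st n w k) (xi n.+1 k j w) - gradF k (st n w k).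

Let K0 : (0 < K)%N. Proof. by case: setting. Qed.

(* Jensen: Assumption 1 on the samples makes the mean gradients L-Lipschitz. *)
Let lipF k x y : sqnorm (gradF k x - gradF k y) <= L ^+ 2 * sqnorm (x - y).
Proof.
have [_ [_ [_ [_ [_ [jg [lip [mean _]]]]]]]] := setting.
exact: (mean_lipschitz (jg k) (mean k) (lip k)).
Qed.

Let mgradF {d1} {T1 : measurableType d1} k (Y : T1 -> 'rV[R]_d) :
  vmeasurable Y -> vmeasurable (fun t => gradF k (Y t)).
Proof.
have [_ [_ [_ [_ [_ [jg [_ [mean _]]]]]]]] := setting.
exact: (vmeasurable_mean (jg k) (mean k)).
Qed.

(** * The samples, and the sigma-algebra of all samples but one *)

Let sample (p : nat * 'I_K * nat) := xi p.1.1 p.1.2 p.2.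

Let valid (p : nat * 'I_K * nat) := (1 <= p.1.1 <= T)%N && (p.2 < b)%N.

(** A finite list, so that [cylinders] applies; [undup] provides the uniqueness that
    [mutually_independent] asks for. *)
Let others (p : nat * 'I_K * nat) : seq (nat * 'I_K * nat) := undup
  [seq q <- [seq (tk, j) | tk <- [seq (t, k) | t <- iota 1 T, k <- enum 'I_K],
                           j <- iota 0 b] | q != p].

Let othersP p q : (q \in others p) = (q != p) && valid q.
Proof.
rewrite mem_undup mem_filter; congr (_ && _); case: q => -[t k] j; rewrite /valid.
have itT u : (u \in iota 1 T) = (1 <= u <= T)%N by rewrite mem_iota add1n ltnS.
have itb u : (u \in iota 0 b) = (u < b)%N by rewrite mem_iota add0n.
apply/allpairsP/idP => [[[tk j']]|/andP[tT jb]].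
  case=> /allpairsP[[t' k']] [tT _ ->]; move: tT.
  by rewrite [fst _]/= [snd _]/= itT itb => tT jb [-> _ ->]; rewrite tT.
exists (t, k, j); split; rewrite ?itb//.
by apply/allpairsP; exists (t, k); split; rewrite ?itT ?mem_enum.
Qed.

(* Omega with the sigma-algebra generated by all samples other than p; for
   p = (t, k, j) the iterates x_t and the other noises of step t are measurable
   for it. *)
Let past (p : nat * 'I_K * nat) := g_sigma_algebraType (cylinders sample (others p)).

Let msample q : valid q -> measurable_fun setT (sample q).
Proof. by move=> /andP[? ?]; have [mxi _] := sampling; exact: mxi. Qed.

Let indep_past p : valid p -> forall (A : set (past p)) B, measurable A -> measurable B ->
  P ((id : Omega -> past p) @^-1` A `&` sample p @^-1` B) =
  (P ((id : Omega -> past p) @^-1` A) * D p.1.2 B)%E.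
Proof.
move=> vp A B mA mB; have [_ [law ind]] := sampling.
have /andP[tT jb] := vp.
rewrite -(law p.1.1 p.1.2 p.2)//.
have mo i : i \in others p -> measurable_fun setT (sample i).
  by rewrite othersP => /andP[_ /msample].
have uo : uniq (p :: others p) by rewrite /= undup_uniq andbT othersP eqxx.
have vo i : i \in p :: others p -> valid i.
  by rewrite inE => /predU1P[->//|]; rewrite othersP => /andP[].
exact: (cylinders_indep mo ind uo vo (msample vp) mA mB).
Qed.

Let mid_past p : measurable_fun setT (id : Omega -> past p).
Proof.
apply: measurable_id_cylinders => i; rewrite othersP => /andP[_]; exact: msample.
Qed.

Let msample_past p q : valid q -> q != p ->
  measurable_fun setT (sample q : past p -> Xi).
Proof. by move=> vq qp; apply: measurable_cylinder_coord; rewrite othersP qp. Qed.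

Let mst n k : (n <= T)%N -> vmeasurable (fun w => st n w k).
Proof.
have [_ [_ [_ [_ [_ [jg _]]]]]] := setting => nT.
apply: vmeasurable_fedavg_state => // t l j /andP[t1 tn] jb.
by have [mxi _] := sampling; apply: mxi => //; rewrite t1 (leq_trans tn).
Qed.

(** The iterate reads only samples of times at most [n], all of which differ from
    [(n.+1, k', j)]. *)
Let mst_past n k k' j : (n < T)%N -> (j < b)%N ->
  vmeasurable ((fun w => st n w k) : past (n.+1, k', j) -> 'rV[R]_d).
Proof.
have [_ [_ [_ [_ [_ [jg _]]]]]] := setting => nT jb.
apply: (@vmeasurable_fedavg_state _ _ _ _ _ _ (past (n.+1, k', j))) => // t l j' /andP[t1 tn] jb'.
apply: (@msample_past _ (t, l, j')); first by rewrite /valid/= t1 jb' (leq_trans tn (ltnW nT)).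
by rewrite !xpair_eqE ltn_eqF.
Qed.

Let noise_sqnorm n k j : (n < T)%N -> (j < b)%N ->
  (\int[P]_w (sqnorm (noise n k j w))%:E <= (sigma ^+ 2)%:E)%E.
Proof.
move=> nT jb.
have [_ [_ [_ [_ [_ [jg [lip [mean [var _]]]]]]]]] := setting.
have vp : valid (n.+1, k, j) by rewrite /valid/= nT jb.
exact: (noise_sqnorm_le (jg k) (mean k) (var k) (@mid_past (n.+1, k, j)) (msample vp)
  (@mst_past n k k j nT jb) (indep_past vp)).
Qed.

Let mnoise n k j : (n < T)%N -> (j < b)%N -> vmeasurable (noise n k j).
Proof.
move=> nT jb; have [_ [_ [_ [_ [_ [jg _]]]]]] := setting.
apply: vmeasurableB; last exact/mgradF/mst/ltnW.
apply: jg; first exact/mst/ltnW.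
by apply: (@msample (n.+1, k, j)); rewrite /valid/= nT.
Qed.

(** Finiteness comes from the extended-valued variance bound and not from moments of the iterates,
    so the induction in [sst] can rely on it. *)
Let snoise n k j : (n < T)%N -> (j < b)%N -> vsqint P (noise n k j).
Proof.
move=> nT jb; have mn := @mnoise n k j nT jb.
apply: (vsqint_dominated (X := fun w => sqnorm (noise n k j w))) => //.
apply/integrableP; split; first exact/measurable_EFinP/measurable_dotv.
apply: le_lt_trans (ltry (sigma ^+ 2)).
apply: le_trans (@noise_sqnorm n k j nT jb); rewrite le_eqVlt; apply/orP; left; apply/eqP.
by apply: eq_integral => z _ /=; rewrite ger0_norm// sqnorm_ge0.
Qed.

Let Enoise_sqnorm n k j : (n < T)%N -> (j < b)%N ->
  \int[P]_w sqnorm (noise n k j w) <= sigma ^+ 2.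
Proof.
move=> nT jb; rewrite -lee_fin /Rintegral fineK ?noise_sqnorm//.
exact/integrable_fin_num/vsqint_sqnorm/snoise.
Qed.

(** Here [U] may use every sample but one, including others of the same step. This covers both the
    inner products with [ebar] and the cross terms of its square. *)
Let noise_orth n k j (U : Omega -> 'rV[R]_d) : (n < T)%N -> (j < b)%N ->
  vmeasurable (U : past (n.+1, k, j) -> 'rV[R]_d) -> vsqint P U ->
  \int[P]_w dotv (U w) (noise n k j w) = 0.
Proof.
move=> nT jb mU sU.
have [_ [_ [_ [_ [_ [jg [lip [mean [var _]]]]]]]]] := setting.
have vp : valid (n.+1, k, j) by rewrite /valid/= nT jb.
rewrite Rintegral_sum; last by move=> i; apply: sqint_mul => //; exact: snoise.
rewrite big1// => i _.
apply: (noise_orthogonal (jg k) (mean k) (@mid_past (n.+1, k, j)) (msample vp)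
  (@mst_past n k k j nT jb) (indep_past vp) (mU i)).
by apply: sqint_mul => //; exact: snoise.
Qed.

Let mnoise_past n k j k' j' : (n < T)%N -> (j < b)%N -> (j' < b)%N ->
  (k', j') != (k, j) ->
  vmeasurable (noise n k' j' : past (n.+1, k, j) -> 'rV[R]_d).
Proof.
move=> nT jb jb' kj; have [_ [_ [_ [_ [_ [jg _]]]]]] := setting.
have ms := @mst_past n k' k j nT jb.
apply: (vmeasurableB (Y := fun w : past (n.+1, k, j) => _)); last exact: mgradF ms.
apply: (jg k' _ (past (n.+1, k, j)) _ _ ms).
apply: (@msample_past _ (n.+1, k', j')); first by rewrite /valid/= nT.
by move: kj; rewrite !xpair_eqE eqxx.
Qed.

(** In the notation of the overview, at [t = n.+1]: [mbar] is [m_t], [ebar] is [e_t], [gbar] is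
    [g_t] and [vbar] is [V_t]. The averaged squared noise [nbar] dominates the average over nodes of
    [sqnorm (enoise n k w)]. *)
Let dir n k w := b%:R^-1 *: \sum_(j < b) gs k (st n w k) (xi n.+1 k j w).
Let enoise n k w := b%:R^-1 *: \sum_(j < b) noise n k j w.
Let mbar n w := avgK (fun k => gradF k (st n w k)).
Let ebar n w := avgK (fun k => enoise n k w).
Let gbar n w := gradobj gradF (xb n w).
Let vbar n w := K%:R^-1 * \sum_k sqnorm (st n w k - xb n w).
Let nbar n w := K%:R^-1 * \sum_k (b%:R^-1 * \sum_(j < b) sqnorm (noise n k j w)).

Let K1 : 0 < K%:R^-1 :> R. Proof. by rewrite invr_gt0 ltr0n. Qed.
Let bn0 : b%:R != 0 :> R. Proof. by rewrite pnatr_eq0 -lt0n. Qed.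
Let Kn0 : K%:R != 0 :> R. Proof. by rewrite pnatr_eq0 -lt0n. Qed.

Let dirE n k w : dir n k w = gradF k (st n w k) + enoise n k w.
Proof.
rewrite /dir /enoise /noise big_split/= sumrN sumr_const card_ord.
by rewrite scalerBr -[gradF _ _ *+ b]scaler_nat scalerA mulVf// scale1r addrC subrK.
Qed.

Let avg_dir n w : avgK (fun k => dir n k w) = mbar n w + ebar n w.
Proof.
rewrite /mbar /ebar /avgK -scalerDr -big_split/=; congr (_ *: _).
by apply: eq_bigr => k _; rewrite dirE.
Qed.

Let xbS n w : xb n.+1 w = xb n w - eta *: (mbar n w + ebar n w).
Proof.
rewrite -avg_dir -avgKZ -avgKB /xb.
have -> : st n.+1 w = fun k => if (n.+1 %% I == 0)%N then
    avgK (fun l => st n w l - eta *: dir n l w) else st n w k - eta *: dir n k w.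
  by apply/funext => k; rewrite fedavg_stateS.
by case: (n.+1 %% I == 0)%N; rewrite ?avgK_cst.
Qed.

(** * Second moments of the iterates and of the averaged noise *)

(** A Lipschitz gradient grows at most linearly away from its value at 0. *)
Let sgradF k (Y : Omega -> 'rV[R]_d) :
  vsqint P Y -> vsqint P (fun w => gradF k (Y w)).
Proof.
move=> sY; apply: (vsqint_dominated (X := fun w =>
  2 * (L ^+ 2 * sqnorm (Y w)) + 2 * sqnorm (gradF k 0))).
- exact/mgradF/vsqint_measurable.
- apply: integrable_EFinD; last exact: integrable_EFin_cst.
  exact/integrable_EFinZ/integrable_EFinZ/vsqint_sqnorm.
- move=> w; rewrite -{1}[gradF k _](subrK (gradF k 0)).
  apply: le_trans (sqnormD_le _ _) _; rewrite lerD2r ler_pM2l//.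
  by apply: le_trans (lipF _ _ _) _; rewrite subr0.
Qed.

Let sst n k : (n <= T)%N -> vsqint P (fun w => st n w k).
Proof.
elim: n k => [k _|n IH k nT]; first exact: vsqint_cst.
have sdir l : vsqint P (fun w => st n w l - eta *: dir n l w).
  have sn : vsqint P (fun w => st n w l) by exact/IH/ltnW.
  apply: vsqintB => //; apply: vsqintZ.
  rewrite (_ : dir n l = fun w => gradF l (st n w l) + enoise n l w); last first.
    by apply/funext => w; exact: dirE.
  apply: vsqintD; first exact: sgradF.
  by apply: vsqintZ; apply: vsqint_sum => j; exact: snoise.
case E : (n.+1 %% I == 0)%N; under eq_fun do rewrite fedavg_stateS E.
  exact: vsqint_avgK.
exact: sdir.
Qed.

Let sxb n : (n <= T)%N -> vsqint P (xb n).
Proof. by move=> nT; apply: vsqint_avgK => k; exact: sst. Qed.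

Let smbar n : (n <= T)%N -> vsqint P (mbar n).
Proof. by move=> nT; apply: vsqint_avgK => k; exact/sgradF/sst. Qed.

Let sgbar n : (n <= T)%N -> vsqint P (gbar n).
Proof. by move=> nT; apply: vsqint_avgK => k; exact/sgradF/sxb. Qed.

Let ebarE n w : ebar n w =
  (K%:R^-1 * b%:R^-1) *: \sum_(p : 'I_K * 'I_b) noise n p.1 p.2 w.
Proof.
rewrite /ebar /enoise /avgK -scaler_sumr scalerA; congr (_ *: _).
by rewrite (pair_bigA _ (fun k j => noise n k (nat_of_ord j) w)).
Qed.

Let sebar n : (n < T)%N -> vsqint P (ebar n).
Proof.
move=> nT; apply: vsqint_avgK => k; apply: vsqintZ; apply: vsqint_sum => j.
exact: snoise.
Qed.

(** The [K * b] noises of one step are pairwise orthogonal, so their variances add up, and the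
    squared prefactor leaves a single factor [(b K)^-1]. *)
Let Eebar n : (n < T)%N ->
  \int[P]_w sqnorm (ebar n w) <= sigma ^+ 2 / (b%:R * K%:R).
Proof.
move=> nT.
have s2 : \int[P]_w sqnorm (\sum_(p : 'I_K * 'I_b) noise n p.1 p.2 w) <=
    (K * b)%:R * sigma ^+ 2.
  rewrite -[in leRHS](card_ord K) -[in leRHS](card_ord b) -card_prod.
  apply: sqnorm_sum_orthogonal.
  - by move=> p; exact: snoise.
  - by move=> p; exact: Enoise_sqnorm.
  - move=> p q pq.
    under eq_Rintegral do rewrite dotvC.
    apply: noise_orth => //; last exact: snoise.
    apply: mnoise_past => //.
    by apply: contra_neq pq => -[]; case: p q => [? ?] [? ?] /= -> /val_inj ->.
under eq_Rintegral do rewrite ebarE sqnormZ.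
rewrite RintegralZl//; last first.
  by apply: vsqint_sqnorm; apply: vsqint_sum => p; exact: snoise.
apply: le_trans (ler_wpM2l (sqr_ge0 _) s2) _.
rewrite le_eqVlt; apply/orP; left; apply/eqP.
by rewrite natrM; field; rewrite Kn0.
Qed.

Let dotv_ebar n (U : Omega -> 'rV[R]_d) : (n < T)%N ->
  (forall k j, (j < b)%N -> vmeasurable (U : past (n.+1, k, j) -> 'rV[R]_d)) ->
  vsqint P U -> \int[P]_w dotv (U w) (ebar n w) = 0.
Proof.
move=> nT mU sU.
under eq_Rintegral do rewrite ebarE dotvZr dotv_sumr.
have iU (p : 'I_K * 'I_b) : P.-integrable setT
    (EFin \o (fun w => dotv (U w) (noise n p.1 p.2 w))).
  by apply: vsqint_dotv => //; exact: snoise.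
rewrite RintegralZl//; last exact: integrable_EFin_sum.
rewrite Rintegral_sum// big1 ?mulr0// => p _.
by apply: noise_orth => //; exact: mU.
Qed.

Let dotv_gbar n : (n < T)%N -> \int[P]_w dotv (gbar n w) (ebar n w) = 0.
Proof.
move=> nT; apply: dotv_ebar => //; last exact/sgbar/ltnW.
move=> k j jb; apply: (@vmeasurable_avgK _ _ (past (n.+1, k, j))) => l.
apply: (@mgradF _ (past (n.+1, k, j)) l (xb n)).
by apply: (@vmeasurable_avgK _ _ (past (n.+1, k, j))) => l'; exact: mst_past.
Qed.

Let dotv_mbar n : (n < T)%N -> \int[P]_w dotv (mbar n w) (ebar n w) = 0.
Proof.
move=> nT; apply: dotv_ebar => //; last exact/smbar/ltnW.
move=> k j jb; apply: (@vmeasurable_avgK _ _ (past (n.+1, k, j))) => l.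
by apply: (@mgradF _ (past (n.+1, k, j)) l (fun w => st n w l)); exact: mst_past.
Qed.

(** * Drift between communication rounds *)

Let ivbar n : (n <= T)%N -> P.-integrable setT (EFin \o vbar n).
Proof.
move=> nT; apply: integrable_EFinZ; apply: integrable_EFin_sum => k.
by apply: vsqint_sqnorm; apply: vsqintB; [exact: sst|exact: sxb].
Qed.

Let inbar n : (n < T)%N -> P.-integrable setT (EFin \o nbar n).
Proof.
move=> nT; apply: integrable_EFinZ; apply: integrable_EFin_sum => k.
apply: integrable_EFinZ; apply: integrable_EFin_sum => j.
exact/vsqint_sqnorm/snoise.
Qed.

(** For the drift a bound without reduction by [b] suffices, so the variances are merely
    averaged. *)
Let Enbar n : (n < T)%N -> \int[P]_w nbar n w <= sigma ^+ 2.
Proof.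
move=> nT.
have i1 k (j : 'I_b) : P.-integrable setT (EFin \o (fun w => sqnorm (noise n k j w))).
  exact/vsqint_sqnorm/snoise.
have i2 k := integrable_EFin_sum (index_enum _) (i1 k).
have i3 k := integrable_EFinZ b%:R^-1 (i2 k).
rewrite RintegralZl//; last exact: integrable_EFin_sum.
rewrite ler_pdivrMl ?ltr0n// Rintegral_sum//.
rewrite -[X in X%:R * _](card_ord K) mulr_natl -sumr_const; apply: ler_sum => k _.
rewrite RintegralZl// ler_pdivrMl ?ltr0n// Rintegral_sum//.
rewrite -[X in X%:R * _](card_ord b) mulr_natl -sumr_const; apply: ler_sum => j _.
exact: Enoise_sqnorm.
Qed.

Let sqnorm_enoise n k w :
  sqnorm (enoise n k w) <= b%:R^-1 * \sum_(j < b) sqnorm (noise n k j w).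
Proof. exact: (sqnorm_avgK_le b0 (fun j : 'I_b => noise n k j w)). Qed.

(** Write [gradF k x] as the average of [K] copies of itself and use convexity of the squared
    norm. *)
Let heterogeneity k x : sqnorm (gradF k x - gradobj gradF x) <= zeta ^+ 2.
Proof.
have [_ [_ [_ [_ [_ [_ [_ [_ [_ het]]]]]]]]] := setting.
rewrite -{1}(avgK_cst K0 (gradF k x)) /gradobj -avgKB.
apply: le_trans (sqnorm_avgK_le K0 _) _; rewrite ler_pdivrMl ?ltr0n//.
by rewrite -[X in X%:R * _](card_ord K) mulr_natl -sumr_const; exact: ler_sum.
Qed.

(** Recentre at [gbar], which can only increase the sum, then split into noise, Lipschitz error and
    heterogeneity; halving twice gives the weights 2, 4 and 4. *)
Let dir_spread n w :
  K%:R^-1 * \sum_k sqnorm (dir n k w - avgK (fun l => dir n l w)) <=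
  2 * nbar n w + 4 * L ^+ 2 * vbar n w + 4 * zeta ^+ 2.
Proof.
rewrite ler_pdivrMl ?ltr0n//.
apply: le_trans (sum_sqnorm_dev_le K0 _ (gbar n w)) _.
have -> : K%:R * (2 * nbar n w + 4 * L ^+ 2 * vbar n w + 4 * zeta ^+ 2) =
  \sum_k (2 * (b%:R^-1 * \sum_(j < b) sqnorm (noise n k j w)) +
    4 * L ^+ 2 * sqnorm (st n w k - xb n w) + 4 * zeta ^+ 2).
  rewrite !big_split/= /nbar /vbar -!mulr_sumr sumr_const card_ord -mulr_natl.
  by field; rewrite bn0 Kn0.
apply: ler_sum => k _.
have -> : dir n k w - gbar n w = enoise n k w +
    ((gradF k (st n w k) - gradF k (xb n w)) + (gradF k (xb n w) - gbar n w)).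
  by rewrite dirE [_ - _ + (_ - _)]addrA subrK addrA [enoise _ _ _ + _]addrC.
have := sqnormD_le (enoise n k w)
  ((gradF k (st n w k) - gradF k (xb n w)) + (gradF k (xb n w) - gbar n w)).
have := sqnormD_le (gradF k (st n w k) - gradF k (xb n w)) (gradF k (xb n w) - gbar n w).
have := sqnorm_enoise n k w; have := heterogeneity k (xb n w).
have := lipF k (st n w k) (xb n w); rewrite -/(gbar n w); lra.
Qed.

Let S := sigma ^+ 2 + zeta ^+ 2.

(** Between rounds each deviation from the average moves by [- eta] times the deviation of its
    direction; Young with weight [s^-1] separates the two, and [s] is fixed in [drift_bound]. *)
Let vbarS n s w : 0 < s -> (n.+1 %% I)%N != 0%N ->
  vbar n.+1 w <= (1 + s^-1) * vbar n w +
    (1 + s) * eta ^+ 2 * (2 * nbar n w + 4 * L ^+ 2 * vbar n w + 4 * zeta ^+ 2).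
Proof.
move=> s0 nI.
apply: (@le_trans _ _ ((1 + s^-1) * vbar n w + (1 + s) * eta ^+ 2 *
    (K%:R^-1 * \sum_k sqnorm (dir n k w - avgK (fun l => dir n l w))))); last first.
  rewrite lerD2l ler_wpM2l ?dir_spread// mulr_ge0 ?sqr_ge0//; lra.
rewrite /vbar (eq_bigr (fun k =>
    sqnorm (st n w k - eta *: dir n k w - xb n.+1 w))); last first.
  by move=> k _; rewrite fedavg_stateS (negbTE nI).
rewrite !mulrA ![_ * K%:R^-1]mulrC -!mulrA -mulrDr ler_pM2l//.
rewrite !mulr_sumr -big_split/=; apply: ler_sum => k _.
rewrite xbS -avg_dir.
have -> : st n w k - eta *: dir n k w - (xb n w - eta *: avgK (fun l => dir n l w)) =
  (st n w k - xb n w) + (- eta) *: (dir n k w - avgK (fun l => dir n l w)).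
  by rewrite scaleNr scalerBr !opprB addrACA [RHS]addrACA [- xb _ _ - _]addrC.
have si0 : 0 < s^-1 by rewrite invr_gt0.
apply: le_trans (sqnormD_young _ _ si0) _.
by rewrite invrK sqnormZ sqrrN !mulrA.
Qed.

Lemma drift_bound n : (n <= T)%N ->
  \int[P]_w vbar n w <= 10 * (n %% I)%:R ^+ 2 * eta ^+ 2 * S.
Proof.
have S0 : 0 <= S by rewrite addr_ge0 ?sqr_ge0.
elim: n => [_|n IH nT].
  rewrite mod0n expr0n/= !(mulr0, mul0r).
  under eq_Rintegral => w _.
    rewrite /vbar big1; last by move=> k _; rewrite /xb avgK_cst// subrr sqnorm0.
    over.
  by rewrite mulr0 Rintegral_prob_cst.
(* A communication round makes all nodes equal, so the drift is zero there. *)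
have [nI|nI] := eqVneq (n.+1 %% I)%N 0%N.
  rewrite nI expr0n/= !(mulr0, mul0r).
  under eq_Rintegral => w _.
    rewrite /vbar big1.
      over.
    move=> k _; rewrite /xb.
    have -> : st n.+1 w = fun k => avgK (fun l => st n w l - eta *: dir n l w).
      by apply/funext => l; rewrite fedavg_stateS nI eqxx.
    by rewrite avgK_cst// subrr sqnorm0.
  by rewrite mulr0 Rintegral_prob_cst.
set r := (n %% I)%N in IH *.
have rI : (r.+1 < I)%N.
  rewrite ltn_neqAle ltn_pmod// andbT; apply: contra_neq nI => rI.
  by rewrite -addn1 -modnDml -/r addn1 rI modnn.
have -> : (n.+1 %% I)%N = r.+1 by rewrite -addn1 -modnDml -/r addn1 modn_small.
have V0 : 0 <= \int[P]_w vbar n w.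
  by apply: Rintegral_ge0 => w _; rewrite mulr_ge0// sumr_ge0// => k _; exact: sqnorm_ge0.
have IHn := IH (ltnW nT).
(* Taking expectations, [2 * sigma ^+ 2 + 4 * zeta ^+ 2] is absorbed into [4 * S]. *)
have step s : 0 < s -> \int[P]_w vbar n.+1 w <= (1 + s^-1) * \int[P]_w vbar n w +
    (1 + s) * eta ^+ 2 * (4 * S + 4 * L ^+ 2 * \int[P]_w vbar n w).
  move=> s0.
  have i1 := integrable_EFinZ (1 + s^-1) (ivbar (ltnW nT)).
  have i2 := integrable_EFinZ 2 (inbar nT).
  have i3 := integrable_EFinZ (4 * L ^+ 2) (ivbar (ltnW nT)).
  have i4 := integrable_EFin_cst P (4 * zeta ^+ 2).
  have i23 := integrable_EFinD i2 i3.
  have i5 := integrable_EFinD i23 i4.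
  have i6 := integrable_EFinZ ((1 + s) * eta ^+ 2) i5.
  have := le_Rintegral measurableT (ivbar nT) (integrable_EFinD i1 i6)
    (fun w _ => vbarS w s0 nI).
  rewrite RintegralD// RintegralZl//; last exact/ivbar/ltnW.
  rewrite RintegralZl// RintegralD// RintegralD// RintegralZl//; last exact: inbar.
  rewrite RintegralZl//; last exact/ivbar/ltnW.
  rewrite Rintegral_prob_cst => /le_trans; apply.
  have := Enbar nT => En; rewrite lerD2l ler_wpM2l//.
    by rewrite mulr_ge0 ?sqr_ge0//; lra.
  by have := sqr_ge0 (sigma); have := sqr_ge0 zeta; rewrite /S; lra.
have eta2 : 0 <= eta ^+ 2 := sqr_ge0 _.
(* Since [r < I], the induction hypothesis gives [4 L^2 E V <= 40 L^2 I^2 eta^2 S <= (40/81) S],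
   which is below [S]. *)
have G5 : 4 * S + 4 * L ^+ 2 * \int[P]_w vbar n w <= 5 * S.
  have r2 : r%:R ^+ 2 <= I%:R ^+ 2 :> R.
    by rewrite lerXn2r ?nnegrE// ler_nat ltnW// ltn_pmod.
  have : L ^+ 2 * \int[P]_w vbar n w <= L ^+ 2 * (10 * I%:R ^+ 2 * eta ^+ 2 * S).
    rewrite ler_wpM2l ?sqr_ge0// (le_trans IHn)// ler_wpM2r// ler_wpM2r// ler_wpM2l//.
  have := ler_wpM2r S0 etaI; lra.
(* For [r = 0] the expected drift is zero and the weight [r] is not positive; [s = 1] gives the
   coefficient [2 * 5 = 10]. *)
have [r0|r0] := posnP r.
  have h := step 1 ltr01; rewrite r0 expr0n/= !(mulr0, mul0r) in IHn.
  have h1 : (1 + 1^-1) * \int[P]_w vbar n w <= 0.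
    by rewrite mulr_ge0_le0// invr1 addr_ge0.
  have h2 : (1 + 1) * eta ^+ 2 * (4 * S + 4 * L ^+ 2 * \int[P]_w vbar n w) <=
     (1 + 1) * eta ^+ 2 * (5 * S).
    by rewrite ler_wpM2l// (mulr_ge0 _ eta2)// addr_ge0.
  apply: le_trans h (le_trans (lerD h1 h2) _).
  by rewrite add0r r0 le_eqVlt; apply/orP; left; apply/eqP; ring.
have rn0 : 0 < r%:R :> R by rewrite ltr0n.
(* With [s = r] the coefficient is [10 r^2 + 15 r + 5], which lies [5 (1 + r)] below
   [10 (1 + r)^2]. *)
apply: le_trans (step r%:R rn0) _.
have ri : 0 < 1 + r%:R^-1 :> R by rewrite addr_gt0// invr_gt0.
have h1 := ler_wpM2l (ltW ri) IHn.
have h2 : (1 + r%:R) * eta ^+ 2 * (4 * S + 4 * L ^+ 2 * \int[P]_w vbar n w) <=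
   (1 + r%:R) * eta ^+ 2 * (5 * S).
  by rewrite ler_wpM2l// mulr_ge0//; lra.
apply: le_trans (lerD h1 h2) _.
have -> : (1 + r%:R^-1) * (10 * r%:R ^+ 2 * eta ^+ 2 * S) + (1 + r%:R) * eta ^+ 2 * (5 * S)
  = (10 * r%:R ^+ 2 + 10 * r%:R + 5 * (1 + r%:R)) * (eta ^+ 2 * S).
  by field; rewrite gt_eqF.
have -> : 10 * r.+1%:R ^+ 2 * eta ^+ 2 * S = (10 * (1 + r%:R) ^+ 2) * (eta ^+ 2 * S).
  by rewrite -natr1; ring.
rewrite ler_wpM2r ?(mulr_ge0 eta2)// -subr_ge0.
suff -> : 10 * (1 + r%:R) ^+ 2 - (10 * r%:R ^+ 2 + 10 * r%:R + 5 * (1 + r%:R)) =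
  5 * (1 + r%:R) :> R by rewrite mulr_ge0// addr_ge0.
by ring.
Qed.

(** * Descent of the objective and the error bound *)

(* The upper bound on f(xbar_(t+1)) - f(xbar_t) of the header, with t = n.+1. *)
Let excess n w := - (eta / 2 * sqnorm (gbar n w)) + eta * L ^+ 2 / 2 * vbar n w +
  L * eta ^+ 2 / 2 * sqnorm (ebar n w) + - eta * dotv (gbar n w) (ebar n w) +
  L * eta ^+ 2 * dotv (mbar n w) (ebar n w).

Let Leta : L * eta <= 1.
Proof.
have Le0 : 0 <= L * eta by rewrite mulr_ge0// ltW.
have I2 : 1 <= I%:R ^+ 2 :> R by rewrite exprn_ege1// ler1n.
have e0 := sqr_ge0 (L * eta); have h := ler_wpM2r e0 I2.
suff : (L * eta) ^+ 2 <= 1 by rewrite expr_le1.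
move: etaI; have -> : 81 * L ^+ 2 * I%:R ^+ 2 * eta ^+ 2 =
  81 * (I%:R ^+ 2 * (L * eta) ^+ 2) by ring.
by move: e0 h; lra.
Qed.

(** The descent inequality is used for each [F k] at the common point [xb n w] and averaged.
    Polarisation turns [- eta <g, m>] into [eta / 2 (|g - m|^2 - |g|^2 - |m|^2)]; the Lipschitz
    property bounds [|g - m|^2], and [L eta <= 1] absorbs the [|m|^2] terms. *)
Let descent_step n w : fobj F (xb n.+1 w) <= fobj F (xb n w) + excess n w.
Proof.
have [_ [_ [_ [isg _]]]] := setting.
pose v := - (eta *: (mbar n w + ebar n w)).
have step : fobj F (xb n.+1 w) <= fobj F (xb n w) + dotv (gbar n w) v + L / 2 * sqnorm v.
  rewrite xbS -/v /fobj ler_pdivrMl ?ltr0n// !mulrDr mulVKf//.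
  rewrite /gbar /gradobj /avgK dotvZl mulVKf// dotv_suml.
  have -> : K%:R * (L / 2 * sqnorm v) = \sum_(k < K) (L / 2 * sqnorm v).
    by rewrite sumr_const card_ord mulr_natl.
  rewrite -!big_split/=.
  apply: ler_sum => k _.
  exact: (descent_inequality (isg k)).
apply: le_trans step _; rewrite -addrA lerD2l /v dotvNr dotvZr sqnormN sqnormZ.
have gm : sqnorm (gbar n w - mbar n w) <= L ^+ 2 * vbar n w.
  rewrite /gbar /gradobj /mbar -avgKB; apply: le_trans (sqnorm_avgK_le K0 _) _.
  rewrite /vbar mulrCA ler_pM2l// mulr_sumr; apply: ler_sum => k _.
  by rewrite sqnormBC.
move: gm; rewrite sqnormB dotvDr sqnormD /excess.
set g2 := sqnorm (gbar n w); set gm := dotv (gbar n w) (mbar n w).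
set ge := dotv _ (ebar n w); set me := dotv (mbar n w) _; set e2 := sqnorm (ebar n w).
set V := vbar n w; have := sqnorm_ge0 (mbar n w); set m2 := sqnorm (mbar n w).
move=> m20 gmV.
have h1 := ler_wpM2l (ltW eta0) gmV.
have h2 : L * eta * (eta * m2) <= 1 * (eta * m2).
  by rewrite ler_wpM2r// mulr_ge0// ltW.
rewrite -subr_ge0.
suff -> : - (eta / 2 * g2) + eta * L ^+ 2 / 2 * V + L * eta ^+ 2 / 2 * e2 +
    - eta * ge + L * eta ^+ 2 * me -
    (- (eta * (gm + ge)) + L / 2 * (eta ^+ 2 * (m2 + 2 * me + e2))) =
    2^-1 * (eta * (L ^+ 2 * V) - eta * (g2 - 2 * gm + m2)) +
    2^-1 * (1 * (eta * m2) - L * eta * (eta * m2)).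
  by rewrite addr_ge0// mulr_ge0// ?invr_ge0// subr_ge0.
by field.
Qed.

Lemma fedavg_error_bound : (0 < T)%N ->
  (fedavg_error P gs gradF xi eta I b T x1 <=
   (2 * (fobj F x1 - fstar) / (eta * T%:R) +
    10 * L ^+ 2 * I%:R ^+ 2 * eta ^+ 2 * (sigma ^+ 2 + zeta ^+ 2) +
    L * eta * sigma ^+ 2 / (b%:R * K%:R))%:E)%E.
Proof.
move=> T0; have [_ [_ [_ [_ [[fsle _] _]]]]] := setting.
have path m w : fobj F (xb m w) <= fobj F x1 + \sum_(0 <= n < m) excess n w.
  elim: m => [|m IH]; first by rewrite big_nil addr0 /xb avgK_cst.
  rewrite big_nat_recr//= addrA; apply: le_trans (descent_step m w) _.
  by rewrite lerD2r.
have ig n : (n < T)%N -> P.-integrable setT (EFin \o (fun w => sqnorm (gbar n w))).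
  by move=> nT; exact/vsqint_sqnorm/sgbar/ltnW.
pose A n := \int[P]_w sqnorm (gbar n w).
(* The drift and variance parts of the expected increase; 5 is half of the 10 in [drift_bound]. *)
pose c := 5 * eta * L ^+ 2 * I%:R ^+ 2 * eta ^+ 2 * S +
  L * eta ^+ 2 / 2 * (sigma ^+ 2 / (b%:R * K%:R)).
have Eexcess n : (n < T)%N -> P.-integrable setT (EFin \o excess n) /\
    \int[P]_w excess n w <= - (eta / 2 * A n) + c.
  move=> nT; have nT' := ltnW nT.
  have iv := ivbar nT'; have ie := vsqint_sqnorm (sebar nT).
  have ige := vsqint_dotv (sgbar nT') (sebar nT).
  have ime := vsqint_dotv (smbar nT') (sebar nT).
  have i1 := integrable_EFinZ (- (eta / 2)) (ig n nT).
  have i2 := integrable_EFinZ (eta * L ^+ 2 / 2) iv.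
  have i3 := integrable_EFinZ (L * eta ^+ 2 / 2) ie.
  have i4 := integrable_EFinZ (- eta) ige.
  have i5 := integrable_EFinZ (L * eta ^+ 2) ime.
  have i12 := integrable_EFinD i1 i2.
  have i123 := integrable_EFinD i12 i3.
  have i1234 := integrable_EFinD i123 i4.
  have i12345 := integrable_EFinD i1234 i5.
  rewrite /excess; under [X in EFin \o X]eq_fun do rewrite -mulNr.
  under eq_Rintegral do rewrite -mulNr.
  split => //.
  rewrite RintegralD// RintegralD// RintegralD// RintegralD//.
  rewrite (RintegralZl _ measurableT (ig n nT)) (RintegralZl _ measurableT iv).
  rewrite (RintegralZl _ measurableT ie) (RintegralZl _ measurableT ige).
  rewrite (RintegralZl _ measurableT ime) dotv_gbar// dotv_mbar//.
  rewrite !mulr0 !addr0 -/(A n) mulNr.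
  rewrite -addrA lerD2l /c; apply: lerD; last first.
    by rewrite ler_wpM2l ?Eebar// divr_ge0// mulr_ge0// ?sqr_ge0// ltW.
  have -> : 5 * eta * L ^+ 2 * I%:R ^+ 2 * eta ^+ 2 * S =
    eta * L ^+ 2 / 2 * (10 * I%:R ^+ 2 * eta ^+ 2 * S) by field.
  apply: ler_wpM2l.
    by rewrite divr_ge0// mulr_ge0// ?sqr_ge0// ltW.
  apply: le_trans (drift_bound nT') _.
  rewrite ler_wpM2r ?addr_ge0 ?sqr_ge0// ler_wpM2r ?sqr_ge0// ler_wpM2l//.
  by rewrite lerXn2r ?nnegrE// ler_nat ltnW// ltn_pmod.
(* [fstar] replaces the objective at the last iterate before integration, so only constants and
   [excess] are integrated. *)
have total : fstar <= fobj F x1 + \sum_(n < T) (- (eta / 2 * A n) + c).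
  have ie (n : 'I_T) : P.-integrable setT (EFin \o excess n).
    by have [] := Eexcess n (ltn_ord n).
  have isum := integrable_EFin_sum (index_enum _) ie.
  have := le_Rintegral measurableT (integrable_EFin_cst P fstar)
    (integrable_EFinD (integrable_EFin_cst P (fobj F x1)) isum).
  rewrite Rintegral_prob_cst RintegralD//; last exact: integrable_EFin_cst.
  rewrite Rintegral_prob_cst Rintegral_sum// => le.
  apply: le_trans (le _) _.
    move=> w _; apply: le_trans (fsle (xb T w)) _.
    by have := path T w; rewrite big_mkord.
  by rewrite lerD2l; apply: ler_sum => n _; have [] := Eexcess n (ltn_ord n).
(* The error counts from [t = 1] and [A] from [n = 0]; finite integrals turn the extended sum into a
   real one. *)
have errE : fedavg_error P gs gradF xi eta I b T x1 =
    (T%:R^-1 * \sum_(n < T) A n)%:E.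
  rewrite /fedavg_error big_add1/= big_mkord EFinM -sumEFin; congr (_ * _)%E.
  apply: eq_bigr => n _; rewrite /A /Rintegral fineK//.
  exact/integrable_fin_num/ig.
rewrite errE lee_fin ler_pdivrMl ?ltr0n//.
move: total; rewrite big_split/= sumrN -mulr_sumr sumr_const card_ord -[c *+ T]mulr_natl /c.
set s := \sum_(n < T) A n => total.
have e2 : 0 < eta / 2 by rewrite divr_gt0.
rewrite -(ler_pM2l e2).
have -> : eta / 2 * (T%:R * (2 * (fobj F x1 - fstar) / (eta * T%:R) +
    10 * L ^+ 2 * I%:R ^+ 2 * eta ^+ 2 * (sigma ^+ 2 + zeta ^+ 2) +
    L * eta * sigma ^+ 2 / (b%:R * K%:R))) =
  fobj F x1 - fstar + T%:R * (5 * eta * L ^+ 2 * I%:R ^+ 2 * eta ^+ 2 * S +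
     L * eta ^+ 2 / 2 * (sigma ^+ 2 / (b%:R * K%:R))).
  by rewrite /S; field; rewrite bn0 Kn0 pnatr_eq0 -lt0n T0 gt_eqF.
lra.
Qed.

End run.

(** * Rates *)

Lemma powR_gt0E {R : realType} (x a : R) : 0 < x -> x `^ a = expR (a * ln x).
Proof. by move=> x0; rewrite /powR gt_eqF. Qed.

Section rates.
Context {R : realType}.
Variables (nu : R) (K T : nat).
Hypotheses (hnu : 0 <= nu <= 1) (K0 : (0 < K)%N) (T0 : (0 < T)%N).

Let k : R := K%:R.
Let t : R := T%:R.
Let r : R := t / k ^+ 3.

Definition fedavg_rate : R := K%:R `^ (nu / 2) * T%:R `^ (2 / 3 - nu / 6).

Let k0 : 0 < k. Proof. by rewrite ltr0n. Qed.
Let t0 : 0 < t. Proof. by rewrite ltr0n. Qed.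
Let r0 : 0 < r. Proof. by rewrite divr_gt0// exprn_gt0. Qed.
Let lnr : ln r = ln t - 3 * ln k.
Proof. by rewrite ln_div ?posrE ?exprn_gt0// lnXn// mulr_natl. Qed.

Lemma fedavg_rate_gt0 : 0 < fedavg_rate.
Proof. by rewrite mulr_gt0// powR_gt0// ltr0n. Qed.

(** Powers become exponentials of combinations of [ln t] and [ln k], whose exponents are compared.
    As [r^(1/3 - nu/3)] is the order of [b], the right side is the order of the sample count
    [b K T], which is also [(eta T)^2]. *)
Lemma fedavg_rate_sqr : fedavg_rate ^+ 2 = r `^ (3^-1 - nu / 3) * k * t.
Proof.
rewrite /fedavg_rate -/k -/t -[in RHS](lnK k0) -[in RHS](lnK t0) !powR_gt0E// lnr.
by rewrite expr2 -!expRD; congr expR; field.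
Qed.

(** The left side is the order of [I^2 b K / T = (I eta)^2], the size of the drift term. *)
Lemma fedavg_rate_inv :
  r `^ (nu / 4) ^+ 2 * r `^ (3^-1 - nu / 3) * k / t = fedavg_rate^-1.
Proof.
rewrite /fedavg_rate -/k -/t -[in LHS](lnK t0) -[X in _ * X / _](lnK k0).
by rewrite !powR_gt0E// lnr expr2 -!expRD -!expRN -!expRD; congr expR; field.
Qed.

(** The right side is [T] over the order of [I], which governs the number of rounds. *)
Lemma fedavg_rate_powR : fedavg_rate `^ (3 / 2) = t / r `^ (nu / 4).
Proof.
rewrite (powR_gt0E _ fedavg_rate_gt0) /fedavg_rate -/k -/t.
rewrite lnM ?posrE ?powR_gt0// !ln_powR -[X in _ = X / _](lnK t0) powR_gt0E// lnr.
by rewrite -expRN -expRD; congr expR; field.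
Qed.

Lemma fedavg_params_bounds (cI cb Cb L eta : R) (I b : nat) :
  0 < cI -> 0 < cb -> 0 < Cb ->
  fedavg_params nu cI cb Cb L K T I b eta ->
  [/\ 0 < eta, 81 * L ^+ 2 * I%:R ^+ 2 * eta ^+ 2 <= 1,
   (eta * t)^-1 <= (Num.sqrt cb)^-1 * fedavg_rate^-1,
   eta / (b%:R * k) <= (Num.sqrt cb)^-1 * fedavg_rate^-1 &
   I%:R ^+ 2 * eta ^+ 2 <= cI ^+ 2 * Cb * fedavg_rate^-1].
Proof.
move=> cI0 cb0 Cb0 [_ [I1 [b1 [etaE [IcI [cbb [bCb LT]]]]]]].
rewrite -/t -/k -/r in etaE IcI cbb bCb LT.
have b0 : 0 < b%:R :> R by rewrite ltr0n.
have eta0 : 0 < eta by rewrite etaE sqrtr_gt0 divr_gt0// mulr_gt0.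
have eta2 : eta ^+ 2 = b%:R * k / t.
  by rewrite etaE sqr_sqrtr// ltW// divr_gt0// mulr_gt0.
have D0 := fedavg_rate_gt0.
have s0 : 0 < Num.sqrt cb by rewrite sqrtr_gt0.
have le1 : (eta * t)^-1 <= (Num.sqrt cb)^-1 * fedavg_rate^-1.
  have et0 : 0 < eta * t by rewrite mulr_gt0.
  have sD0 : 0 < Num.sqrt cb * fedavg_rate by rewrite mulr_gt0.
  rewrite -invfM lef_pV2 ?posrE//.
  rewrite -(ler_pXn2r (n := 2)) ?nnegrE ?(ltW et0) ?(ltW sD0)//.
  rewrite [leLHS]exprMn [leRHS]exprMn (sqr_sqrtr (ltW cb0)) fedavg_rate_sqr eta2.
  have -> : b%:R * k / t * t ^+ 2 = b%:R * (k * t) by field; rewrite gt_eqF.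
  by rewrite -!mulrA [leLHS]mulrA ler_wpM2r// mulr_ge0// ltW.
split => //.
- rewrite eta2 !mulrA ler_pdivrMr// mul1r; move: LT; rewrite -/k !mulrA//.
(* Because [eta^2 = b K / T], the noise coefficient equals that of the initial gap. *)
- suff -> : eta / (b%:R * k) = (eta * t)^-1 by [].
  apply: (mulfI (lt0r_neq0 eta0)); rewrite mulrA -expr2 eta2.
  by field; rewrite !gt_eqF.
- have h1 : I%:R ^+ 2 <= (cI * r `^ (nu / 4)) ^+ 2 :> R.
    by rewrite lerXn2r ?nnegrE// mulr_ge0// ?powR_ge0// ltW.
  have h2 : I%:R ^+ 2 * b%:R <= (cI * r `^ (nu / 4)) ^+ 2 *
      (Cb * r `^ (3^-1 - nu / 3)).
    by rewrite ler_pM// exprn_ge0.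
  have kt : 0 <= k / t by rewrite divr_ge0// ltW.
  have tn0 : t != 0 by rewrite gt_eqF.
  have -> : I%:R ^+ 2 * eta ^+ 2 = I%:R ^+ 2 * b%:R * (k / t).
    by rewrite eta2; field.
  apply: le_trans (ler_wpM2r kt h2) _; rewrite -fedavg_rate_inv.
  by rewrite le_eqVlt; apply/orP; left; apply/eqP; field.
Qed.

End rates.

Lemma fedavg_convergence_rate {R : realType} (nu : R) (hnu : 0 <= nu <= 1)
    (cI cb Cb L : R) : 0 < cI -> 0 < cb -> 0 < Cb -> 0 < L ->
  exists C : R, 0 < C /\
  forall (d K : nat) (dX : measure_display) (Xi : measurableType dX)
    (D : 'I_K -> probability Xi R)
    (fs : 'I_K -> 'rV[R]_d -> Xi -> R) (gs : 'I_K -> 'rV[R]_d -> Xi -> 'rV[R]_d)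
    (F : 'I_K -> 'rV[R]_d -> R) (gradF : 'I_K -> 'rV[R]_d -> 'rV[R]_d)
    (fstar sigma zeta : R) (x1 : 'rV[R]_d)
    (dO : measure_display) (Omega : measurableType dO) (P : probability Omega R)
    (xi : nat -> 'I_K -> nat -> Omega -> Xi) (T I b : nat) (eta : R),
  fedavg_setting D fs gs F gradF fstar L sigma zeta ->
  fedavg_sampling P D xi T b ->
  fedavg_params nu cI cb Cb L K T I b eta ->
  (fedavg_error P gs gradF xi eta I b T x1 <=
   (C * (fobj F x1 - fstar + sigma ^+ 2 + zeta ^+ 2) / fedavg_rate nu K T)%:E)%E.
Proof.
move=> cI0 cb0 Cb0 L0.
pose s := (Num.sqrt cb)^-1; pose q := cI ^+ 2 * Cb.
have s0 : 0 < s by rewrite invr_gt0 sqrtr_gt0.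
have q0 : 0 < q by rewrite mulr_gt0// exprn_gt0.
(* The summands come from the initial gap, the drift and the averaged noise. *)
exists (2 * s + 10 * L ^+ 2 * q + L * s); split.
  by rewrite !addr_gt0// !mulr_gt0// exprn_gt0.
move=> d K dX Xi D fs gs F gradF fstar sigma zeta x1 dO Omega P xi T I b eta.
move=> setting sampling params.
have [K0 [_ [_ [_ [[fsle _] _]]]]] := setting.
have [T0 [I0 [b0 _]]] := params.
have [eta0 etaI h1 h2 h3] := fedavg_params_bounds K0 T0 cI0 cb0 Cb0 params.
apply: le_trans (fedavg_error_bound x1 setting sampling L0 I0 b0 eta0 etaI T0) _.
rewrite lee_fin; move: h1 h2 h3; rewrite -/s -/q.
have v0 : 0 < (fedavg_rate nu K T)^-1 by rewrite invr_gt0 fedavg_rate_gt0.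
set v := (fedavg_rate nu K T)^-1 in v0 *; move=> h1 h2 h3.
have Delta0 : 0 <= fobj F x1 - fstar by rewrite subr_ge0.
set Delta := fobj F x1 - fstar in Delta0 *.
have s2 := sqr_ge0 sigma; have z2 := sqr_ge0 zeta.
have sv : 0 <= s * v by rewrite mulr_ge0// ltW.
have qv : 0 <= 10 * L ^+ 2 * (q * v) by rewrite !mulr_ge0// ?sqr_ge0// ltW.
have Lsv : 0 <= L * (s * v) by rewrite mulr_ge0// ltW.
have e1 : 2 * Delta / (eta * T%:R) <= 2 * (s * v) * Delta.
  by rewrite mulrAC ler_wpM2r// ler_pM2l.
have e2 : 10 * L ^+ 2 * I%:R ^+ 2 * eta ^+ 2 * (sigma ^+ 2 + zeta ^+ 2) <=
    10 * L ^+ 2 * (q * v) * (sigma ^+ 2 + zeta ^+ 2).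
  rewrite ler_wpM2r ?addr_ge0// -mulrA ler_wpM2l// mulr_ge0// sqr_ge0//.
have e3 : L * eta * sigma ^+ 2 / (b%:R * K%:R) <= L * (s * v) * sigma ^+ 2.
  have -> : L * eta * sigma ^+ 2 / (b%:R * K%:R) =
    L * (eta / (b%:R * K%:R)) * sigma ^+ 2 by rewrite !mulrA; ring.
  by rewrite ler_wpM2r// ler_pM2l.
apply: le_trans (lerD (lerD e1 e2) e3) _.
rewrite -subr_ge0.
(* What remains are products of one coefficient with quantities belonging to the other terms, all
   nonnegative. *)
suff -> : (2 * s + 10 * L ^+ 2 * q + L * s) * (Delta + sigma ^+ 2 + zeta ^+ 2) * v -
    (2 * (s * v) * Delta + 10 * L ^+ 2 * (q * v) * (sigma ^+ 2 + zeta ^+ 2) +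
     L * (s * v) * sigma ^+ 2) =
    2 * (s * v) * (sigma ^+ 2 + zeta ^+ 2) + 10 * L ^+ 2 * (q * v) * Delta +
    L * (s * v) * (Delta + zeta ^+ 2).
  have p1 : 0 <= 2 * (s * v) * (sigma ^+ 2 + zeta ^+ 2).
    exact: mulr_ge0 (mulr_ge0 (ler0n _ 2) sv) (addr_ge0 s2 z2).
  exact: addr_ge0 (addr_ge0 p1 (mulr_ge0 qv Delta0)) (mulr_ge0 Lsv (addr_ge0 Delta0 z2)).
by ring.
Qed.

(** A deterministic choice of parameters, with [M] the numerator of the rate bound: [T] puts the
    rate between [M / eps] and [2 M / eps], and [I], [b] are their truncated orders. [C] is fixed
    before [K]; only the threshold [eps0] depends on [K]. *)
Lemma fedavg_complexity {R : realType} (nu : R) (hnu : 0 <= nu <= 1)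
    (L M : R) : 0 < L -> 0 < M ->
  exists C : R, 0 < C /\ forall K : nat, (0 < K)%N ->
  exists eps0 : R, 0 < eps0 /\ forall eps : R, 0 < eps < eps0 ->
  exists (T I b : nat) (eta : R),
    [/\ fedavg_params nu 1 2^-1 1 L K T I b eta,
     (T * b * K)%:R <= C / eps ^+ 2,
     T%:R / I%:R <= C * eps `^ (- (3 / 2)) &
     M / fedavg_rate nu K T <= eps].
Proof.
move=> L0 M0; have /andP[nu0 nu1] := hnu.
pose a := 2 / 3 - nu / 6.
have a0 : 0 < a by rewrite /a; lra.
have a1 : a <= 1 by rewrite /a; lra.
(* The summands bound [rate^2] and [2 rate^(3/2)] when the rate is at most [2 M / eps]. *)
pose C := 4 * M ^+ 2 + 2 * (2 * M) `^ (3 / 2).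
have C1 : 0 < 4 * M ^+ 2 by rewrite mulr_gt0// exprn_gt0.
have C2 : 0 < 2 * (2 * M) `^ (3 / 2) by rewrite mulr_gt0// powR_gt0// mulr_gt0.
exists C; split; first exact: addr_gt0.
move=> K K0; have k0 : 0 < K%:R :> R by rewrite ltr0n.
have k1 : 1 <= K%:R :> R by rewrite ler1n.
pose k : R := K%:R.
(* Chosen so that [r >= R0] gives both [r >= 1] and [81 L^2 <= r^(1/2)]. *)
pose R0 := 1 + (81 * L ^+ 2) ^+ 2.
have R01 : 1 <= R0 by rewrite /R0 lerDl sqr_ge0.
have kR0 : 1 <= k ^+ 3 * R0.
  by rewrite -[leLHS]mulr1 ler_pM// exprn_ege1.
have kR00 : 0 < k ^+ 3 * R0 := lt_le_trans ltr01 kR0.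
have kn0 : 0 < k `^ (nu / 2) by exact: powR_gt0.
have kRa0 : 0 < (k ^+ 3 * R0) `^ a by exact: powR_gt0.
(* Below this threshold [Y] is at least [(K^3 R0)^a], which leads to [r >= R0]. *)
exists (M / (k `^ (nu / 2) * (k ^+ 3 * R0) `^ a)); split.
  by rewrite divr_gt0// mulr_gt0.
move=> eps /andP[eps0 epslt].
pose Y := M / (k `^ (nu / 2) * eps).
have Y0 : 0 < Y by rewrite divr_gt0// mulr_gt0.
have YR : (k ^+ 3 * R0) `^ a <= Y.
  rewrite ler_pdivlMr ?mulr_gt0//; apply: ltW.
  by move: epslt; rewrite ltr_pdivlMr ?mulr_gt0//; congr (_ < _); ring.
(* The real horizon at which the rate is exactly [M / eps]; [T] is the next integer, at most [2 X]
   because [X >= 1]. *)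
pose X := Y `^ a^-1.
have XR : k ^+ 3 * R0 <= X.
  have -> : k ^+ 3 * R0 = ((k ^+ 3 * R0) `^ a) `^ a^-1.
    by rewrite -powRrM divff ?gt_eqF// powRr1// ltW.
  by rewrite ge0_ler_powR ?nnegrE ?invr_ge0// ltW.
have X1 : 1 <= X := le_trans kR0 XR.
have X0 : 0 < X := lt_le_trans ltr01 X1.
pose T := (Num.truncn X).+1; pose t : R := T%:R.
have T0 : (0 < T)%N by [].
have Xt : X <= t by exact/ltW/truncnS_gt.
have tX : t <= 2 * X.
  have : (Num.truncn X)%:R <= X by rewrite truncn_le ltW.
  by rewrite /t /T -natr1; lra.
have t0 : 0 < t by rewrite ltr0n.
pose r := t / k ^+ 3.
have rR : R0 <= r by rewrite ler_pdivlMr ?exprn_gt0// mulrC (le_trans XR).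
have r1 : 1 <= r := le_trans R01 rR.
have r0 : 0 < r := lt_le_trans ltr01 r1.
have ge1 (e : R) : 0 <= e -> 1 <= r `^ e.
  by move=> e0; rewrite -(powRr0 r) ler_powR.
(* Truncating a number that is at least 1 loses at most a factor 2; hence the constant [2^-1] for
   [b] and the factor 2 in the number of rounds. *)
have trunc_half (z : R) : 1 <= z -> z <= 2 * (Num.truncn z)%:R.
  move=> z1; have := truncnS_gt z; rewrite -natr1.
  have : 1 <= (Num.truncn z)%:R :> R by rewrite ler1n truncn_gt0.
  lra.
have zI : 1 <= r `^ (nu / 4) by apply: ge1; lra.
have zb : 1 <= r `^ (3^-1 - nu / 3) by apply: ge1; lra.
pose I := Num.truncn (r `^ (nu / 4)); pose b := Num.truncn (r `^ (3^-1 - nu / 3)).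
have Ile : I%:R <= r `^ (nu / 4) by rewrite truncn_le powR_ge0.
have ble : b%:R <= r `^ (3^-1 - nu / 3) by rewrite truncn_le powR_ge0.
have I0 : (0 < I)%N by rewrite truncn_gt0.
have b0 : (0 < b)%N by rewrite truncn_gt0.
have rate0 := fedavg_rate_gt0 nu K0 T0.
have rateE : fedavg_rate nu K T = k `^ (nu / 2) * t `^ a by [].
have YX : Y = X `^ a by rewrite -powRrM mulVf ?gt_eqF// powRr1// ltW.
have MY : M / eps = k `^ (nu / 2) * Y.
  by rewrite /Y; field; rewrite !gt_eqF.
have rate_ge : M / eps <= fedavg_rate nu K T.
  by rewrite MY rateE ler_pM2l// YX ge0_ler_powR ?nnegrE// ltW.
(* Doubling the horizon multiplies the rate by [2^a], at most 2 since [a <= 1]. *)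
have rate_le : fedavg_rate nu K T <= 2 * M / eps.
  rewrite -mulrA MY rateE mulrCA ler_pM2l// YX.
  apply: (@le_trans _ _ ((2 * X) `^ a)).
    by rewrite ge0_ler_powR ?nnegrE// ?ltW// mulr_gt0.
  rewrite (powRM _ (ler0n _ 2) (ltW X0)) ler_pM2r ?powR_gt0//.
  by rewrite -[leRHS](powRr1 (ltW (ltr0n R 2))) ler_powR// ler1n.
exists T, I, b, (Num.sqrt (b%:R * K%:R / T%:R)); split.
- split => //; split => //; split => //; split => //.
  rewrite mul1r; split => //; split.
    by rewrite ler_pdivrMl//; exact: trunc_half.
  rewrite mul1r; split => //.
  have r12 : 81 * L ^+ 2 <= r `^ 2^-1.
    have L2 : 0 <= 81 * L ^+ 2 by rewrite mulr_ge0// sqr_ge0.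
    rewrite -[leLHS](ger0_norm L2) -sqrtr_sqr powR12_sqrt ?(ltW r0)// ler_wsqrtr//.
    by rewrite (le_trans _ rR)// /R0 lerDr.
  (* The exponents add up to [1/3 + nu/6], which is at most [1/2]. *)
  have Ib : I%:R ^+ 2 * b%:R <= r `^ 2^-1.
    apply: (@le_trans _ _ (r `^ (nu / 4) ^+ 2 * r `^ (3^-1 - nu / 3))).
      by rewrite ler_pM ?exprn_ge0// lerXn2r ?nnegrE// powR_ge0.
    rewrite expr2 -!powRD ?(gt_eqF r0) ?implybT//.
    by rewrite ler_powR//; lra.
  have k13 : k <= k ^+ 3 by rewrite -[leLHS]expr1 ler_weXn2l.
  have h0 : 0 <= 81 * L ^+ 2 by rewrite mulr_ge0// sqr_ge0.
  have h1 : 0 <= I%:R ^+ 2 * b%:R :> R by rewrite mulr_ge0// exprn_ge0.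
  (* Two factors of size at most [r^(1/2)] give [r], and then [K <= K^3] bounds [r K] by [T]. *)
  have h2 : 81 * L ^+ 2 * (I%:R ^+ 2 * b%:R) <= r.
    apply: (le_trans (ler_pM h0 h1 r12 Ib)).
    have half2 : 2^-1 + 2^-1 = 1 :> R by field.
    by rewrite -powRD ?(gt_eqF r0) ?implybT// half2 powRr1// ltW.
  have := ler_pM (mulr_ge0 h0 h1) (ler0n _ K) h2 k13.
  rewrite /r divfK ?gt_eqF ?exprn_gt0//.
  by rewrite !mulrA.
- rewrite !natrM -/t -/k.
  apply: (@le_trans _ _ (fedavg_rate nu K T ^+ 2)).
    rewrite fedavg_rate_sqr// -/t -/k -/r.
    by rewrite [t * _]mulrC -!mulrA [t * k]mulrC ler_wpM2r// mulr_ge0// ltW.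
  apply: (@le_trans _ _ ((2 * M / eps) ^+ 2)).
    by rewrite lerXn2r ?nnegrE// ltW// ?divr_gt0// mulr_gt0.
  rewrite expr_div_n ler_pM2r ?invr_gt0 ?exprn_gt0// /C exprMn.
  by rewrite -natrX lerDl ltW.
- apply: (@le_trans _ _ (2 * fedavg_rate nu K T `^ (3 / 2))).
    rewrite fedavg_rate_powR// -/t -/k -/r mulrCA ler_pM2l//.
    rewrite -[leRHS]invrK lef_pV2 ?posrE ?ltr0n ?invr_gt0//; last first.
      by rewrite divr_gt0// (lt_le_trans ltr01).
    by rewrite invf_div ler_pdivrMr// [leRHS]mulrC; exact: trunc_half.
  apply: (@le_trans _ _ (2 * (2 * M / eps) `^ (3 / 2))).
    rewrite ler_pM2l// ge0_ler_powR ?nnegrE// ltW// ?divr_gt0// mulr_gt0//.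
  have M20 : 0 < 2 * M by rewrite mulr_gt0.
  have -> : (2 * M / eps) `^ (3 / 2) = (2 * M) `^ (3 / 2) * eps `^ (- (3 / 2)).
    rewrite (powR_gt0E _ (divr_gt0 M20 eps0)) (powR_gt0E _ M20) (powR_gt0E _ eps0).
    by rewrite ln_div ?posrE// -expRD; congr expR; ring.
  by rewrite mulrA ler_pM2r ?powR_gt0// /C lerDr ltW.
- by rewrite ler_pdivrMr// mulrC -ler_pdivrMr.
Qed.

Theorem theorem2 (R : realType) (nu : R) (hnu : 0 <= nu <= 1) :
  (* (i): rate, for every choice of the hidden constants in the parameter orders *)
  (forall cI cb Cb L : R, 0 < cI -> 0 < cb -> 0 < Cb -> 0 < L ->
   exists C : R, 0 < C /\
   forall (d K : nat) (dX : measure_display) (Xi : measurableType dX)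
     (D : 'I_K -> probability Xi R)
     (fs : 'I_K -> 'rV[R]_d -> Xi -> R) (gs : 'I_K -> 'rV[R]_d -> Xi -> 'rV[R]_d)
     (F : 'I_K -> 'rV[R]_d -> R) (gradF : 'I_K -> 'rV[R]_d -> 'rV[R]_d)
     (fstar sigma zeta : R) (x1 : 'rV[R]_d)
     (dO : measure_display) (Omega : measurableType dO) (P : probability Omega R)
     (xi : nat -> 'I_K -> nat -> Omega -> Xi) (T I b : nat) (eta : R),
   fedavg_setting D fs gs F gradF fstar L sigma zeta ->
   fedavg_sampling P D xi T b ->
   fedavg_params nu cI cb Cb L K T I b eta ->
   (fedavg_error P gs gradF xi eta I b T x1 <=
    (C * (fobj F x1 - fstar + sigma ^+ 2 + zeta ^+ 2)
       / (K%:R `^ (nu / 2) * T%:R `^ (2 / 3 - nu / 6)))%:E)%E)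
  /\
  (* (ii): sample complexity O(eps^-2) (K-independent) and
     communication complexity O(eps^-3/2) *)
  (forall L Delta sigma zeta : R, 0 < L -> 0 <= Delta -> 0 <= sigma -> 0 <= zeta ->
   exists C cI cb Cb : R, 0 < C /\ 0 < cI /\ 0 < cb /\ 0 < Cb /\
   forall K : nat, (0 < K)%N ->
   exists eps0 : R, 0 < eps0 /\
   forall eps : R, 0 < eps < eps0 ->
   exists (T I b : nat) (eta : R),
     fedavg_params nu cI cb Cb L K T I b eta /\
     (T * b * K)%:R <= C / eps ^+ 2 /\
     T%:R / I%:R <= C * eps `^ (- (3 / 2)) /\
     forall (d : nat) (dX : measure_display) (Xi : measurableType dX)
       (D : 'I_K -> probability Xi R)
       (fs : 'I_K -> 'rV[R]_d -> Xi -> R) (gs : 'I_K -> 'rV[R]_d -> Xi -> 'rV[R]_d)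
       (F : 'I_K -> 'rV[R]_d -> R) (gradF : 'I_K -> 'rV[R]_d -> 'rV[R]_d)
       (fstar : R) (x1 : 'rV[R]_d)
       (dO : measure_display) (Omega : measurableType dO) (P : probability Omega R)
       (xi : nat -> 'I_K -> nat -> Omega -> Xi),
     fedavg_setting D fs gs F gradF fstar L sigma zeta ->
     fobj F x1 - fstar <= Delta ->
     fedavg_sampling P D xi T b ->
     (fedavg_error P gs gradF xi eta I b T x1 <= eps%:E)%E).
Proof.
split=> [cI cb Cb L|L Delta sigma zeta L0 Delta0 sigma0 zeta0].
  exact: fedavg_convergence_rate.
have half0 : 0 < 2^-1 :> R by rewrite invr_gt0.
(* The constants 1, 1/2 and 1 are those realised by the parameters of [fedavg_complexity]. *)
have [C0 [C00 rate]] := fedavg_convergence_rate hnu ltr01 half0 ltr01 L0.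
have S0 : 0 <= Delta + sigma ^+ 2 + zeta ^+ 2 by rewrite !addr_ge0// sqr_ge0.
(* Adding 1 keeps [M] positive when [Delta], [sigma] and [zeta] all vanish. *)
pose M := C0 * (Delta + sigma ^+ 2 + zeta ^+ 2) + 1.
have M0 : 0 < M by rewrite ltr_wpDl// mulr_ge0// ltW.
have [C [C1 complexity]] := fedavg_complexity hnu L0 M0.
exists C, 1, 2^-1, 1; do 4 split=> //.
move=> K /complexity[eps0 [eps00 {}complexity]]; exists eps0; split=> // eps.
move=> /complexity[T [I [b [eta [params samples rounds le_eps]]]]].
exists T, I, b, eta; do 3 split=> //.
move=> d dX Xi D fs gs F gradF fstar x1 dO Omega P xi setting Delta_ge sampling.
have K0 : (0 < K)%N by case: setting.
have T0 : (0 < T)%N by case: params.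
apply: le_trans (rate _ _ _ _ _ _ _ _ _ _ _ _ x1 _ _ _ _ _ _ _ _ setting sampling params) _.
rewrite lee_fin; apply: le_trans le_eps.
rewrite ler_pM2r ?invr_gt0 ?fedavg_rate_gt0//.
apply: (@le_trans _ _ (C0 * (Delta + sigma ^+ 2 + zeta ^+ 2))).
  by rewrite ler_pM2l// !lerD2r.
by rewrite lerDl.
Qed.
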